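(* Let $\Omega$ be a bounded convex domain in $\mathbb{R}^d$, $d\ge2$, with $C^2$ boundary. There exist $r_0>0$ depending only on $\Omega$ and $C>0$ depending only on $d$ such that the following holds. Let $x_0\in\partial\Omega$ and $0<r<r_0$, and suppose that $u\in C^2(\overline{D(x_0,2r)};\mathbb{R}^d)$ and $\phi\in C^1(\overline{D(x_0,2r)})$ satisfy $$-\Delta u+\nabla\phi=0\ \text{ in }D(x_0,2r),\qquad \mathrm{div}(u)=0\ \text{ in }D(x_0,2r),\qquad \frac{\partial u}{\partial\nu}=0\ \text{ on }I(x_0,2r).$$ Then $$\int_{D(x_0,r)}(|\nabla^2u|+|\nabla\phi|)^2\le\frac{C}{r^2}\int_{D(x_0,2r)}(|\nabla u|+|\phi|)^2.$$
   Context: For $x_0\in\partial\Omega$ and $r>0$: $D(x_0,r)=B(x_0,r)\cap\Omega$ and $I(x_0,r)=B(x_0,r)\cap\partial\Omega$. $n$ is the outward unit normal to $\partial\Omega$ and $\frac{\partial u}{\partial\nu}=\frac{\partial u}{\partial n}-\phi n$. *)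

(* Defs.v *)
From HB Require Import structures.
From mathcomp Require Import all_boot all_order all_algebra.
From mathcomp Require Import all_classical all_reals all_analysis.

Set Implicit Arguments.
Unset Strict Implicit.
Unset Printing Implicit Defensive.

Import Order.TTheory GRing.Theory Num.Theory.
Import numFieldTopology.Exports numFieldNormedType.Exports.

Local Open Scope classical_set_scope.
Local Open Scope ring_scope.

(* 'rV[R]_n carries the sigma-algebra generated by the coordinates, which is the
   Borel sigma-algebra. *)
Definition rV_display : measure_display -> measure_display.
Proof. exact. Qed.

Section rV_measurable.
Context {R : realType}.
Variable n : nat.

Let coords : 'I_n -> 'rV[R]_n -> measurableTypeR R := fun i x => x 0 i.

Let rV_set0 : g_sigma_preimage coords set0.
Proof. exact: sigma_algebra0. Qed.

Let rV_setC A : g_sigma_preimage coords A -> g_sigma_preimage coords (~` A).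
Proof. exact: sigma_algebraC. Qed.

Let rV_bigcup (F : _^nat) : (forall i, g_sigma_preimage coords (F i)) ->
  g_sigma_preimage coords (\bigcup_i (F i)).
Proof. exact: sigma_algebra_bigcup. Qed.

HB.instance Definition _ :=
  @isMeasurable.Build (rV_display (R.-ocitv.-measurable).-sigma)
    'rV[R]_n (g_sigma_preimage coords) rV_set0 rV_setC rV_bigcup.

End rV_measurable.

Section rV_measurable_fun.
Context {R : realType}.

Lemma measurable_rV_coord n (i : 'I_n) :
  measurable_fun [set: 'rV[R]_n] (fun x => x 0 i : measurableTypeR R).
Proof.
move=> _ Y mY; rewrite setTI; apply: sub_sigma_algebra => /=.
rewrite -bigcup_seq/=; exists i => /=; first by rewrite mem_index_enum.
by exists Y => //; rewrite setTI.
Qed.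

Lemma measurable_fun_rV d (T : measurableType d) n (f : T -> 'rV[R]_n) :
  (forall i, measurable_fun setT (fun x => f x 0 i : measurableTypeR R)) ->
  measurable_fun setT f.
Proof.
move=> mf _ Y mY; rewrite setTI.
pose S : set (set 'rV[R]_n) := image_set_system setT f measurable.
suff : S Y by rewrite /S /image_set_system /= setTI.
have sS : sigma_algebra setT S.
  by apply: sigma_algebra_image; exact: sigma_algebra_measurable.
move: Y mY; apply: smallest_sub => // A.
rewrite -bigcup_seq/= => -[i _ [B mB <-]].
rewrite /S /image_set_system /= !setTI.
by have := mf i measurableT B mB; rewrite setTI.
Qed.

Definition rV_cons n (p : measurableTypeR R * 'rV[R]_n) : 'rV[R]_n.+1 :=
  row_mx (p.1 : R)%:M p.2.

Definition rV_behead n (x : 'rV[R]_n.+1) : 'rV[R]_n :=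
  \row_j x 0 (lift ord0 j).

Lemma rV_cons0 n p : @rV_cons n p 0 ord0 = p.1.
Proof.
have := row_mxEl ((p.1 : R)%:M : 'M[R]_1) p.2 0 0.
by rewrite [in RHS]mxE eqxx mulr1n => <-; congr (row_mx _ _ _ _); exact/val_inj.
Qed.

Lemma rV_consS n p j : @rV_cons n p 0 (lift ord0 j) = p.2 0 j.
Proof.
rewrite -(row_mxEr ((p.1 : R)%:M : 'M[R]_1) p.2 0 j).
by congr (row_mx _ _ _ _); exact/val_inj.
Qed.

Lemma rV_behead_cons n p : rV_behead (@rV_cons n p) = p.2.
Proof. by apply/rowP => j; rewrite mxE rV_consS. Qed.

Lemma measurable_rV_cons n : measurable_fun setT (@rV_cons n).
Proof.
apply: measurable_fun_rV => i; case: (unliftP ord0 i) => [j|] ->.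
  rewrite (_ : (fun _ => _) = (fun y : 'rV[R]_n => y 0 j) \o snd).
    by apply: measurableT_comp => //; exact: measurable_rV_coord.
  by apply/funext => p /=; rewrite rV_consS.
rewrite (_ : (fun _ => _) = fst); first exact: measurable_fst.
by apply/funext => p /=; rewrite rV_cons0.
Qed.

Lemma measurable_rV_behead n : measurable_fun setT (@rV_behead n).
Proof.
apply: measurable_fun_rV => j.
rewrite (_ : (fun _ => _) = fun x : 'rV[R]_n.+1 => x 0 (lift ord0 j)).
  exact: measurable_rV_coord.
by apply/funext => x; rewrite mxE.
Qed.

End rV_measurable_fun.

Section lebesgue_rVS.
Context {R : realType} {n : nat}.
Variable mu : {sigma_finite_measure set 'rV[R]_n -> \bar R}.

Definition lebesgue_rVS : set 'rV[R]_n.+1 -> \bar R :=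
  pushforward (lebesgue_measure \x mu)%E (@rV_cons R n).

Let lebesgue_rVS0 : lebesgue_rVS set0 = 0%E.
Proof. by rewrite /lebesgue_rVS /pushforward preimage_set0 measure0. Qed.

Let lebesgue_rVS_ge0 A : (0 <= lebesgue_rVS A)%E.
Proof. by rewrite /lebesgue_rVS /pushforward; exact: measure_ge0. Qed.

Let lebesgue_rVS_sigma_additive : semi_sigma_additive lebesgue_rVS.
Proof.
move=> F mF tF mUF; rewrite /lebesgue_rVS /pushforward preimage_bigcup.
apply: measure_semi_sigma_additive.
- by move=> k; rewrite -[X in measurable X]setTI; exact: measurable_rV_cons.
- apply/trivIsetP => /= i j _ _ ij; rewrite -preimage_setI.
  by move/trivIsetP : tF => /(_ _ _ _ _ ij) ->//; rewrite preimage_set0.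
- rewrite -preimage_bigcup -[X in measurable X]setTI.
  exact: measurable_rV_cons.
Qed.

HB.instance Definition _ := isMeasure.Build _ _ _ lebesgue_rVS
  lebesgue_rVS0 lebesgue_rVS_ge0 lebesgue_rVS_sigma_additive.

Let lebesgue_rVS_sigma_finite : sigma_finite setT lebesgue_rVS.
Proof.
have /sigma_finiteP[F [FT Fnd Foo]] := sigma_finiteT (@lebesgue_measure R).
have /sigma_finiteP[G [GT Gnd Goo]] := sigma_finiteT mu.
exists (fun k => [set x : 'rV[R]_n.+1 | F k (x 0 ord0) /\ G k (rV_behead x)]).
  apply/seteqP; split => [x _|//].
  have [i _ Fi] : (\bigcup_i F i) (x 0 ord0) by rewrite -FT.
  have [j _ Gj] : (\bigcup_i G i) (rV_behead x) by rewrite -GT.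
  exists (maxn i j) => //; split.
    by move: Fi; exact/subsetPset/Fnd/leq_maxl.
  by move: Gj; exact/subsetPset/Gnd/leq_maxr.
move=> k; have [mF Fk] := Foo k; have [mG Gk] := Goo k; split.
  rewrite (_ : mkset _ = (fun x : 'rV[R]_n.+1 => x 0 ord0) @^-1` F k `&`
    @rV_behead R n @^-1` G k)//.
  apply: measurableI; rewrite -[X in measurable X]setTI.
    exact: measurable_rV_coord.
  exact: measurable_rV_behead.
rewrite /lebesgue_rVS /pushforward (_ : _ @^-1` _ = F k `*` G k).
  by rewrite product_measure1E// lte_mul_pinfty// ge0_fin_numE.
by apply/seteqP; split=> p /=; rewrite rV_cons0 rV_behead_cons.
Qed.

HB.instance Definition _ := Measure_isSigmaFinite.Build _ _ _ lebesgue_rVS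
  lebesgue_rVS_sigma_finite.

End lebesgue_rVS.

(* The n-dimensional Lebesgue measure, as an iterated product; [lebesgue_rV_box]
   gives its values on boxes. *)
Fixpoint lebesgue_rV {R : realType} (n : nat) :
    {sigma_finite_measure set 'rV[R]_n -> \bar R} :=
  if n is m.+1 then lebesgue_rVS (@lebesgue_rV R m) else dirac (0 : 'rV[R]_0).

Lemma lebesgue_rV_box (R : realType) n (A : 'I_n -> set (measurableTypeR R)) :
  (forall i, measurable (A i)) ->
  lebesgue_rV n [set x : 'rV[R]_n | forall i, A i (x 0 i)] =
  (\prod_(i < n) lebesgue_measure (A i))%E.
Proof.
elim: n A => [|n ih] A mA.
  by rewrite big_ord0 /= diracE mem_set// => -[].
rewrite big_ord_recl -ih//= /lebesgue_rVS /pushforward -product_measure1E//.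
- congr (_ _); apply/seteqP; split => [p Ap|p [Ap0 Ap] i] /=.
    split => /=; first by have := Ap ord0; rewrite rV_cons0.
    by move=> i; have := Ap (lift ord0 i); rewrite rV_consS.
  case: (unliftP ord0 i) => [j|] ->; last by rewrite rV_cons0.
  by rewrite rV_consS; exact: Ap.
- rewrite (_ : mkset _ = \big[setI/setT]_(i < n)
      (fun x : 'rV[R]_n => x 0 i) @^-1` A (lift ord0 i)).
    apply: bigsetI_measurable => i _; rewrite -[X in measurable X]setTI.
    exact: measurable_rV_coord.
  rewrite -bigcap_seq; apply/seteqP; split=> x Ax i; first by move=> _; exact: Ax.
  by apply: (Ax i); rewrite /= mem_index_enum.
Qed.

Definition boundary {T : topologicalType} (A : set T) : set T :=
  closure A `\` interior A.

(* The library norm on 'rV[R]_n is the sup norm, and its [ball]s are cubes. *)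
Definition enorm {R : realType} {n : nat} (x : 'rV[R]_n) : R :=
  Num.sqrt (\sum_i x 0 i ^+ 2).

Definition eball {R : realType} {n : nat} (x : 'rV[R]_n) (r : R) :
    set 'rV[R]_n :=
  [set y | enorm (y - x) < r].

Definition partial {R : realType} {n : nat} {W : normedModType R} (i : 'I_n)
    (f : 'rV[R]_n -> W) : 'rV[R]_n -> W :=
  fun x => 'D_(delta_mx 0 i) f x.

(* [Ckbar k D f], for D open: f is of class C^k on the closure of D, that is,
   f is continuous there, and its partial derivatives up to order k exist in D
   and extend continuously to the closure of D. *)
Fixpoint Ckbar {R : realType} {n : nat} {W : normedModType R} (k : nat)
    (D : set 'rV[R]_n) (f : 'rV[R]_n -> W) : Prop :=
  {within closure D, continuous f} /\
  if k is k'.+1 then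
    forall i : 'I_n,
      (forall x, D x -> derivable f x (delta_mx 0 i)) /\
      exists g, (forall x, D x -> g x = partial i f x) /\ Ckbar k' D g
  else True.

(* The continuous extension to the closure of D of the partial derivative. *)
Definition partialbar {R : realType} {n : nat} {W : normedModType R}
    (D : set 'rV[R]_n) (i : 'I_n) (f : 'rV[R]_n -> W) : 'rV[R]_n -> W :=
  fun y => lim (partial i f x @[x --> within D (nbhs y)]).

Definition grad {R : realType} {n : nat} (f : 'rV[R]_n -> R) (x : 'rV[R]_n) :
    'rV[R]_n :=
  \row_i partial i f x.

Definition laplacian {R : realType} {n m : nat} (u : 'rV[R]_n -> 'rV[R]_m)
    (x : 'rV[R]_n) : 'rV[R]_m :=
  \sum_i partial i (partial i u) x.

Definition div {R : realType} {n : nat} (u : 'rV[R]_n -> 'rV[R]_n)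
    (x : 'rV[R]_n) : R :=
  \sum_i partial i u x 0 i.

Definition grad_norm {R : realType} {n m : nat} (u : 'rV[R]_n -> 'rV[R]_m)
    (x : 'rV[R]_n) : R :=
  Num.sqrt (\sum_i \sum_k partial i u x 0 k ^+ 2).

Definition hess_norm {R : realType} {n m : nat} (u : 'rV[R]_n -> 'rV[R]_m)
    (x : 'rV[R]_n) : R :=
  Num.sqrt (\sum_i \sum_j \sum_k partial i (partial j u) x 0 k ^+ 2).

(* Inside the ball B(y, s), Omega is the set lying on one side of a C^k graph
   over the hyperplane orthogonal to the i-th axis; [b] is the side, and
   [col' i x] is x with its i-th coordinate removed. *)
Definition local_graph {R : realType} {n : nat} (k : nat)
    (Omega : set 'rV[R]_n) (y : 'rV[R]_n) (s : R) (i : 'I_n) (b : bool)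
    (psi : 'rV[R]_n.-1 -> R) : Prop :=
  [/\ 0 < s, Ckbar k setT psi &
      Omega `&` eball y s =
      [set x | psi (col' i x) < (-1) ^+ b * x 0 i] `&` eball y s].

Definition Ck_boundary {R : realType} {n : nat} (k : nat)
    (Omega : set 'rV[R]_n) : Prop :=
  forall y, boundary Omega y -> exists s i b psi, local_graph k Omega y s i b psi.

(* Near y, Omega is the set where rho < 0, so grad rho y points outwards. *)
Definition outward_unit_normal {R : realType} {n : nat} (Omega : set 'rV[R]_n)
    (y nu : 'rV[R]_n) : Prop :=
  exists s i b psi, local_graph 1 Omega y s i b psi /\
    let rho (x : 'rV[R]_n) := psi (col' i x) - (-1) ^+ b * x 0 i in
    nu = (enorm (grad rho y))^-1 *: grad rho y.

(* The conormal derivative at the boundary point y, where the unit normal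
   is nu; the values of the derivatives of u at y are the limits from D. *)
Definition conormal {R : realType} {n : nat} (D : set 'rV[R]_n)
    (u : 'rV[R]_n -> 'rV[R]_n) (phi : 'rV[R]_n -> R) (nu y : 'rV[R]_n) :
    'rV[R]_n :=
  \sum_j nu 0 j *: partialbar D j u y - phi y *: nu.

Definition Dset {R : realType} {n : nat} (Omega : set 'rV[R]_n)
    (x0 : 'rV[R]_n) (r : R) : set 'rV[R]_n := eball x0 r `&` Omega.

Definition Iset {R : realType} {n : nat} (Omega : set 'rV[R]_n)
    (x0 : 'rV[R]_n) (r : R) : set 'rV[R]_n := eball x0 r `&` boundary Omega.

(* Main.v *)
Require Import Defs.
From mathcomp Require Import all_boot all_order all_algebra.
From mathcomp Require Import all_classical all_reals all_analysis.
From mathcomp Require Import measurable_realfun ring lra.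

(* Write F_kj = d_j u_k - phi delta_jk.  The equations say that every row F_k
   is divergence free, and the boundary condition says that F_k is tangent to
   the boundary.  Since div u = 0, the sum over k of d_i F_kj d_j F_ki equals
   |D^2 u|^2 + |grad phi|^2, so the estimate is the identity
     int d_i v_j d_j v_i = int (div v)^2 - (second fundamental form)(v, v)
   for the tangent field v = (cutoff) F_k, in which the boundary term has the
   good sign because the domain is convex.

   The boundary integral is never formed.  Near x0 the domain is {rho < 0} with
   rho(x) = psi(x') - (+-)x_i, which convexity of the domain makes convex.
   With q = (1 + eps / rho)^+, which vanishes where rho >= -eps, the field
   zeta q^2 F_k has compact support in the domain, so only the identity
   int d_i A d_j B = int d_j A d_i B for compactly supported C^1 functions is
   needed; that one is exact for difference quotients, by translation
   invariance of the Lebesgue measure.  Differentiating q produces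
   (eps / rho^2) F . D(F . grad rho), minus the Hessian of rho at (F, F), which
   is nonnegative, and a second integration by parts puts all the derivatives
   of the first term on the weight.  What remains is bounded because the normal
   part F . grad rho vanishes on the boundary, hence is O(|rho|), and it tends
   to 0 pointwise as eps -> 0; dominated convergence concludes. *)

Set Implicit Arguments.
Unset Strict Implicit.
Unset Printing Implicit Defensive.

Import Order.TTheory GRing.Theory Num.Theory.
Import numFieldTopology.Exports numFieldNormedType.Exports.

Local Open Scope classical_set_scope.
Local Open Scope ring_scope.

(** * Directional derivatives *)

(** The constant may depend on [d] only, whereas the charts come with uncontrolled C^2 norms. So
    nothing quantitative about rho may survive: its Hessian enters only through its sign, and every
    bound involving rho merely provides a dominating constant for the limit eps -> 0, in which the
    terms it controls disappear. This dictates q = (1 + eps / rho)^+. Where q > 0 its gradient is -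
    (eps / rho^2) grad rho, so with F . grad rho = O(|rho|) the error becomes a polynomial in q and
    t = eps / rho in which every power of t is accompanied by at least as many factors q; q |t| <= 1
    bounds it uniformly and t -> 0 removes it. The square on q is there because the positive part is
    only Lipschitz while its square is C^1. The field F is only C^1 too, hence the form of the
    integration by parts: an exchange of two derivatives between two functions, without second
    derivatives. The dimension enters through the trace of the identity matrix: the pressure part of
    F contributes d |grad phi|^2 to |DF|^2, but |grad phi|^2 to the quadratic form. *)

Section directional_derivatives.
Context {R : realType} {V : normedModType R}.
Implicit Types (f : V -> R) (x v w : V).

Lemma derive_lineE f x v (t : R) :
  (fun h => h^-1 *: ((f \o shift (x + t *: v)) (h *: v) - f (x + t *: v))) =
  (fun h => h^-1 *: (((fun s : R => f (x + s *: v)) \o shift t) (h *: 1) -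
    f (x + t *: v))).
Proof.
apply/funext => h /=; congr (_ *: (f _ - _)).
by rewrite [h *: 1]mulr1 scalerDl addrCA addrC.
Qed.

Lemma is_derive_line f x v (t df : R) :
  is_derive (x + t *: v) v f df <-> is_derive t 1 (fun s => f (x + s *: v)) df.
Proof.
split=> -[d <-]; split.
- by rewrite /derivable -derive_lineE.
- by rewrite /derive -derive_lineE.
- by rewrite /derivable derive_lineE.
- by rewrite /derive derive_lineE.
Qed.

Lemma is_derive_line0 f x v (df : R) :
  is_derive x v f df <-> is_derive (0 : R) 1 (fun s => f (x + s *: v)) df.
Proof. by rewrite -is_derive_line scale0r addr0. Qed.

Lemma is_derive1_continuous (f : R -> R) (x df : R) :
  is_derive x 1 f df -> {for x, continuous f}.
Proof.
by move=> [fx _]; apply/differentiable_continuous; rewrite -derivable1_diffP.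
Qed.

Lemma is_derive_scale f x v (c df : R) :
  is_derive x v f df -> is_derive x (c *: v) f (c * df).
Proof.
move=> /is_derive_line0 fx; apply/is_derive_line0.
have -> : (fun s => f (x + s *: (c *: v))) =
    (fun s => f (x + s *: v)) \o (fun s => c * s).
  by apply/funext => s /=; rewrite scalerA mulrC.
have cd : is_derive (0 : R) (1 : R) (fun s : R => c * s) c.
  have := @is_deriveZ R R^o R^o id c 0 1 1 _.
  by rewrite [_ *: _]mulr1; apply.
have := @is_derive1_comp R _ _ 0 df c _ cd.
by rewrite mulr0 mulrC; apply.
Qed.

Lemma is_derive_comp_real (P : R -> R) f x v (dP df : R) :
  is_derive x v f df -> is_derive (f x) 1 P dP ->
  is_derive x v (P \o f) (dP * df).
Proof.
move=> /is_derive_line0 fx Px; apply/is_derive_line0.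
have := @is_derive1_comp R P (fun s => f (x + s *: v)) 0 dP df.
by rewrite scale0r addr0; apply.
Qed.

Lemma MVT_line f (df : V -> R) x v (h : R) : 0 < h ->
  (forall t, 0 <= t <= h -> is_derive (x + t *: v) v f (df (x + t *: v))) ->
  exists2 c, 0 < c < h & f (x + h *: v) - f x = h * df (x + c *: v).
Proof.
move=> h0 fd.
have [||c cI] := @MVT R (fun s => f (x + s *: v)) (fun s => df (x + s *: v)) _ _ h0.
- move=> t /[!in_itv]/= /andP[t0 th]; apply/is_derive_line; apply: fd.
  by rewrite !ltW.
- apply/continuous_in_subspaceT => t; rewrite inE/= in_itv/= => /fd.
  by rewrite is_derive_line => /is_derive1_continuous.
rewrite scale0r addr0 subr0 => fE; exists c; last by rewrite fE mulrC.
by move: cI; rewrite in_itv.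
Qed.

Lemma MVT_line_abs f (df : V -> R) x v (h : R) :
  (forall t, `|t| <= `|h| -> is_derive (x + t *: v) v f (df (x + t *: v))) ->
  exists2 c, `|c| <= `|h| & f (x + h *: v) - f x = h * df (x + c *: v).
Proof.
move=> fd; have [h0|h0|->] := ltgtP h 0; last first.
- by exists 0 => //; rewrite scale0r addr0 subrr mul0r.
- have [t t0|c /andP[c0 ch] ->] := @MVT_line f df x v h h0.
    by apply: fd; case/andP: t0 => t0 th; rewrite !ger0_norm// (le_trans t0).
  by exists c => //; rewrite !gtr0_norm// ltW.
- have [|t /andP[t0 th]|c /andP[c0 ch]] := @MVT_line f df (x + h *: v) v (- h).
    by rewrite oppr_gt0.
  rewrite -addrA -scalerDl; apply: fd; rewrite (ltr0_norm h0).
  by rewrite ler_norml; apply/andP; split; lra.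
- rewrite -!addrA -!scalerDl subrr scale0r addr0 => fE; exists (h + c).
    by rewrite (ltr0_norm h0) ler_norml; apply/andP; split; lra.
  by rewrite -opprB fE mulNr opprK.
Qed.

Lemma near_line2 x v w (P : V -> Prop) : (\forall y \near x, P y) ->
  exists2 e : R, 0 < e & forall a b, `|a| <= e -> `|b| <= e ->
    P (x + a *: v + b *: w).
Proof.
move=> /nbhs_ballP[d /= d0 dP].
have D0 : 0 < `|v| + `|w| + 1 by rewrite ltr_wpDl// addr_ge0.
exists (d / 2 / (`|v| + `|w| + 1)); first by rewrite !divr_gt0.
move=> a b; rewrite !ler_pdivlMr// => ad bd; apply: dP.
rewrite -ball_normE /ball_/= -addrA opprD addNKr normrN.
apply: (le_lt_trans (ler_normD _ _)); rewrite !normrZ.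
have := normr_ge0 v; have := normr_ge0 w; have := normr_ge0 a.
have := normr_ge0 b; nra.
Qed.

(** The increment is split at [x + h *: v]; the mean value theorem along [w] turns the second piece
    into [h] times a value of [g] near [x]. In this way a derivative along any vector is assembled
    from continuous partial derivatives, one coordinate at a time. *)
Lemma is_derive_add f (g : V -> R) x v w (a : R) : is_derive x v f a ->
  (\forall y \near x, is_derive y w f (g y)) -> {for x, continuous g} ->
  is_derive x (v + w) f (a + g x).
Proof.
move=> [fv fva] fw cg.
have cv1 : (fun h => h^-1 *: ((f \o shift x) (h *: v) - f x)) @ 0^' --> a.
  by rewrite -fva.
have key : (fun h => h^-1 *: ((f \o shift x) (h *: (v + w)) - f x)) @ 0^' -->
    a + g x.
  have -> : (fun h => h^-1 *: ((f \o shift x) (h *: (v + w)) - f x)) =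
    (fun h => h^-1 *: ((f \o shift x) (h *: v) - f x) +
      h^-1 *: (f (x + h *: v + h *: w) - f (x + h *: v))).
    apply/funext => h /=; rewrite -scalerDr; congr (_ *: _).
    have -> : h *: (v + w) + x = x + h *: v + h *: w.
      by rewrite scalerDr addrC addrA.
    by rewrite (addrC _ x); ring.
  apply: cvgD => //; apply/cvgrPdist_le => e e0.
  have [|d d0 dP] := @near_line2 x v w
      (fun y => is_derive y w f (g y) /\ `|g x - g y| <= e).
    near=> y; split; first by near: y.
    by near: y; move/cvgrPdist_le : cg; exact.
  near=> h.
  have h0 : h != 0 by near: h; exact: nbhs_dnbhs_neq.
  have hd : `|h| <= d.
    by near: h; exact: dnbhs0_le.
  have [t th|c ch ->] := @MVT_line_abs f g (x + h *: v) w h.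
    by apply: (dP _ _ _ _).1 => //; exact: le_trans th hd.
  rewrite [_ *: _]mulKf//.
  by apply: (dP _ _ _ _).2 => //; exact: le_trans ch hd.
by split; [apply/cvg_ex; exists (a + g x)|apply/cvg_lim].
Unshelve. all: by end_near. Qed.

Lemma is_derive_translate f x v c (df : R) :
  is_derive (x + c) v f df -> is_derive x v (fun y => f (y + c)) df.
Proof.
have E : (fun h => h^-1 *: ((f \o shift (x + c)) (h *: v) - f (x + c))) =
  (fun h => h^-1 *: (((fun y => f (y + c)) \o shift x) (h *: v) - f (x + c))).
  by apply/funext => h /=; rewrite addrA.
by move=> [d <-]; split; [rewrite /derivable -E|rewrite /derive -E].
Qed.

(** The second difference is the increment along [v] of [F y = f (y + d *: w) - f y]: one mean value
    for [F], one for [a]. Used in both orders of [v] and [w] it gives the symmetry of second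
    derivatives; with [v = w] it turns midpoint convexity into a sign of the Hessian. *)
Lemma MVT_mixed f (a p : V -> R) x v w (d : R) : 0 < d ->
  (forall s t, `|s| <= d -> `|t| <= d -> let y := x + s *: v + t *: w in
    is_derive y v f (a y) /\ is_derive y w a (p y)) ->
  exists s t, [/\ `|s| <= d, `|t| <= d &
    f (x + d *: v + d *: w) - f (x + d *: v) - (f (x + d *: w) - f x) =
    d * (d * p (x + s *: v + t *: w))].
Proof.
move=> d0 fap; have dd : `|d| <= d by rewrite gtr0_norm.
have d00 : `|0 : R| <= d by rewrite normr0 ltW.
have le_d t : 0 <= t <= d -> `|t| <= d by move=> /andP[? ?]; rewrite ger0_norm.
have lt_d t : 0 < t < d -> `|t| <= d.
  by move=> /andP[? ?]; rewrite ger0_norm ltW.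
pose F y := f (y + d *: w) - f y.
have [t /le_d td|c /lt_d cd cE] :=
    @MVT_line F (fun y => a (y + d *: w) - a y) x v d d0.
  have [f1 _] := fap t d td dd.
  have [f2 _] := fap t 0 td d00; rewrite scale0r addr0 in f2.
  by apply: is_deriveB; exact: is_derive_translate.
have [t /le_d td|e /lt_d ed eE] := @MVT_line a p (x + c *: v) w d d0.
  exact: (fap c t cd td).2.
by exists c, e; split => //; rewrite -eE -cE /F (addrAC x).
Qed.

(** The second difference is symmetric in [v] and [w], so [MVT_mixed] in the two orders equates a
    value of [p] with a value of [q], at two points arbitrarily close to [x]. *)
Lemma schwarz f (a b p q : V -> R) x v w :
  (\forall y \near x, is_derive y v f (a y)) ->
  (\forall y \near x, is_derive y w f (b y)) ->
  (\forall y \near x, is_derive y w a (p y)) ->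
  (\forall y \near x, is_derive y v b (q y)) ->
  {for x, continuous p} -> {for x, continuous q} -> p x = q x.
Proof.
move=> fa fb ap bq cp cq; apply/eqP; rewrite -subr_eq0 -normr_le0.
apply/ler_addgt0Pr => e e0; rewrite add0r.
have [|d d0 dP] := @near_line2 x v w (fun y =>
    [/\ is_derive y v f (a y), is_derive y w f (b y), is_derive y w a (p y),
    is_derive y v b (q y) & `|p x - p y| <= e / 2 /\ `|q x - q y| <= e / 2]).
  near=> y; split; try by near: y.
  by split; near: y; [move/cvgrPdist_le : cp|move/cvgrPdist_le : cq]; apply;
    rewrite divr_gt0.
have [s t sd td|s [t [sd td stE]]] := @MVT_mixed f a p x v w d d0.
  by have [] := dP s t sd td.
have [s' t' sd' td'|t' [s' [td' sd' stE']]] := @MVT_mixed f b q x w v d d0.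
  by rewrite addrAC; have [] := dP t' s' td' sd'.
have pq : p (x + s *: v + t *: w) = q (x + s' *: v + t' *: w).
  have dd : d * d != 0 by rewrite mulf_neq0// gt_eqF.
  apply: (mulfI dd); rewrite -!mulrA -stE.
  rewrite (addrAC x (s' *: v)) -stE' (addrAC x (d *: w)); ring.
have [_ _ _ _ [pe _]] := dP s t sd td.
have [_ _ _ _ [_ qe]] := dP s' t' sd' td'.
have -> : p x - q x = (p x - p (x + s *: v + t *: w)) +
  (q (x + s' *: v + t' *: w) - q x) by rewrite pq; ring.
rewrite (splitr e) (le_trans (ler_normD _ _))// lerD//.
by rewrite distrC.
Unshelve. all: by end_near. Qed.

End directional_derivatives.

(** * C^1 functions with explicit partial derivatives; the squared positive part *)

Section C1_functions.
Context {R : realType} {n : nat}.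
Local Notation V := 'rV[R]_n.
Local Notation e_ i := (delta_mx 0 i : V).
Implicit Types (D : set V) (f g : V -> R).

(** The partial derivatives are carried as data, so that the product and chain rules below compute
    them and [C1_eq] can then bring them to a chosen closed form by [ring]. *)
Definition C1 D f (df : 'I_n -> V -> R) := forall x, D x ->
  {for x, continuous f} /\
  forall i, is_derive x (e_ i) f (df i x) /\ {for x, continuous (df i)}.

Lemma is_derive_C1 D f df x v : open D -> C1 D f df -> D x ->
  is_derive x v f (\sum_i v 0 i * df i x).
Proof.
move=> oD fC Dx; rewrite [v in is_derive _ v](row_sum_delta v).
have DN : \forall y \near x, D y by exact: open_nbhs_nbhs.
elim: (index_enum _) => [|i r IH]; first by rewrite !big_nil; exact: is_derive0.
rewrite !big_cons addrC (addrC (v 0 i *: _)).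
apply: (@is_derive_add _ _ _ (fun y => v 0 i * df i y)) => //.
  near=> y; apply: is_derive_scale; have Dy : D y by near: y.
  exact: ((fC y Dy).2 i).1.
apply: (@cvgM _ _ (nbhs x) _ (cst (v 0 i)) (df i)); first exact: cvg_cst.
exact: ((fC x Dx).2 i).2.
Unshelve. all: by end_near. Qed.

Lemma cvg_sumr (T : Type) (F : set_system T) {FF : Filter F} (I : Type)
    (r : seq I) (P : pred I) (f : I -> T -> R) (a : I -> R) :
  (forall i, P i -> f i x @[x --> F] --> a i) ->
  \sum_(i <- r | P i) f i x @[x --> F] --> \sum_(i <- r | P i) a i.
Proof. by apply: cvg_big; exact: add_continuous. Qed.

Lemma C1_cst D (c : R) : C1 D (cst c) (fun _ _ => 0).
Proof.
move=> x _; split; first exact: cst_continuous.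
by move=> i; split; [exact: is_derive_cst|exact: cst_continuous].
Qed.

Lemma C1D D f df g dg : C1 D f df -> C1 D g dg ->
  C1 D (fun x => f x + g x) (fun i x => df i x + dg i x).
Proof.
move=> fC gC x Dx; have [cf fd] := fC x Dx; have [cg gd] := gC x Dx.
split; first by apply: cvgD cf cg.
move=> i; have [fi cfi] := fd i; have [gi cgi] := gd i.
by split; [exact: is_deriveD|apply: cvgD cfi cgi].
Qed.

Lemma C1M D f df g dg : C1 D f df -> C1 D g dg ->
  C1 D (fun x => f x * g x) (fun i x => df i x * g x + f x * dg i x).
Proof.
move=> fC gC x Dx; have [cf fd] := fC x Dx; have [cg gd] := gC x Dx.
split; first by apply: cvgM cf cg.
move=> i; have [fi cfi] := fd i; have [gi cgi] := gd i.
split; last by apply: cvgD (cvgM cfi cg) (cvgM cf cgi).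
have := @is_deriveM R V f g x (e_ i) _ _ fi gi.
by rewrite /GRing.scale/= addrC (mulrC (g x)).
Qed.

Lemma C1_sum D m (F : 'I_m -> V -> R) dF : (forall j, C1 D (F j) (dF j)) ->
  C1 D (fun x => \sum_j F j x) (fun i x => \sum_j dF j i x).
Proof.
move=> FC x Dx; split.
  by apply: (@cvg_sumr _ (nbhs x) _ _ _ xpredT F) => j _; exact: (FC j x Dx).1.
move=> i; split; last first.
  apply: (@cvg_sumr _ (nbhs x) _ _ _ xpredT (dF ^~ i)) => j _.
  exact: ((FC j x Dx).2 i).2.
have := @is_derive_sum R V R m F x (e_ i) (fun j => dF j i x)
  (fun j => ((FC j x Dx).2 i).1).
by rewrite fct_sumE.
Qed.

Lemma C1_comp D f df (P dP : R -> R) : C1 D f df ->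
  (forall x, D x -> is_derive (f x) 1 P (dP (f x)) /\
    {for f x, continuous dP}) ->
  C1 D (fun x => P (f x)) (fun i x => dP (f x) * df i x).
Proof.
move=> fC PC x Dx; have [cf fd] := fC x Dx; have [Pd cdP] := PC x Dx.
split.
  by apply: (@continuous_comp _ _ _ f P) => //; exact: is_derive1_continuous Pd.
move=> i; have [fi cfi] := fd i; split; first exact: is_derive_comp_real.
apply: (@cvgM _ _ (nbhs x) _ (dP \o f) (df i)) => //.
exact: continuous_comp.
Qed.

Lemma near_eq_continuous (T : topologicalType) (U : topologicalType)
    (f g : T -> U) x :
  (\forall y \near x, f y = g y) -> {for x, continuous f} ->
  {for x, continuous g}.
Proof.
move=> fg cf; rewrite /prop_for /continuous_at -(nbhs_singleton fg).
exact: cvg_trans (near_eq_cvg fg) cf.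
Qed.

Lemma C1_eq D f g df dg : open D -> (forall x, D x -> f x = g x) ->
  (forall x, D x -> forall i, df i x = dg i x) ->
  C1 D f df -> C1 D g dg.
Proof.
move=> oD fg dfg fC x Dx; have [cf fd] := fC x Dx.
have DN : \forall y \near x, D y by exact: open_nbhs_nbhs.
have fgN : \forall y \near x, f y = g y by near=> y; apply: fg; near: y.
split; first exact: near_eq_continuous cf.
move=> i; have [fi cfi] := fd i; split.
  by rewrite -dfg//; exact: near_eq_is_derive fi.
by apply: near_eq_continuous cfi; near=> y; apply: dfg; near: y.
Unshelve. all: by end_near. Qed.

Lemma C1_coord i : C1 setT (fun x : V => x 0 i) (fun j _ => (j == i)%:R).
Proof.
move=> x _; split; first exact: coord_continuous.
move=> j; split; last exact: cst_continuous.
apply/is_derive_line0.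
have -> : (fun s : R => (x + s *: e_ j) 0 i) = (fun s => x 0 i + (j == i)%:R * s).
  by apply/funext => s; rewrite !mxE/= eq_sym mulrC.
have cd := @is_deriveZ R R^o R^o id (j == i)%:R 0 1 1 _.
have := @is_deriveD R R^o R^o (cst (x 0 i)) _ 0 1 0 _ _ (cd _).
by rewrite add0r [_ *: _]mulr1; apply.
Qed.

Definition pos (t : R) := Num.max t 0.

Lemma pos_continuous : continuous pos.
Proof. by move=> t; apply: (@continuous_max R R id (cst 0)) => //; exact: cst_continuous. Qed.

(** Squaring removes the kink at 0, where the difference quotient is 0 or [h]. For this reason the
    positive part enters the cutoffs below through its square. *)
Lemma is_derive_pos2 (t : R) : is_derive t 1 (fun s => pos s ^+ 2) (2 * pos t).
Proof.
have [t0|t0|->] := ltgtP t 0.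
- have -> : 2 * pos t = 0 by rewrite /pos max_r ?mulr0// ltW.
  apply: (@near_eq_is_derive _ _ _ (cst 0)).
    by near=> s; rewrite /= /pos max_r ?expr0n// ltW//; near: s; exact: lt_nbhsl.
- have -> : 2 * pos t = 2 * t by rewrite /pos max_l// ltW.
  have sq : is_derive t 1 (fun s : R => s ^+ 2) (2 * t).
    have := @is_deriveX R R^o id 2 t 1 1 _.
    by rewrite expr1 [_ *: _]mulr1; apply.
  apply: near_eq_is_derive sq.
  by near=> s; rewrite /= /pos max_l// ltW//; near: s; exact: lt_nbhsr.
- have -> : 2 * pos 0 = 0 by rewrite /pos max_r ?mulr0.
  have key : (fun h : R => h^-1 *: (((fun s => pos s ^+ 2) \o shift 0) (h *: 1) -
      pos 0 ^+ 2)) @ 0^' --> (0 : R).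
    apply/cvgrPdist_le => e e0; near=> h.
    have h0 : h != 0 by near: h; exact: nbhs_dnbhs_neq.
    have he : `|h| <= e by near: h; exact: dnbhs0_le.
    rewrite /= addr0 [h *: 1]mulr1 /pos maxxx expr0n/= subr0 sub0r normrN.
    have -> a : h^-1 *: (a : R) = h^-1 * a by [].
    have [h_le0|h_gt0] := leP h 0.
      by rewrite expr0n mulr0 normr0 ltW.
    by rewrite expr2 mulKf.
  by split; [apply/cvg_ex; exists 0|apply/cvg_lim].
Unshelve. all: by end_near. Qed.

End C1_functions.

(** * Lebesgue measure on row vectors *)

Section rV_borel.
Context {R : realType} {n : nat}.
Local Notation V := 'rV[R]_n.
Implicit Types (D U : set V) (f : V -> R).

Lemma measurable_box (A : 'I_n -> set (measurableTypeR R)) :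
  (forall i, measurable (A i)) ->
  measurable [set x : V | forall i, A i (x 0 i)].
Proof.
move=> mA; rewrite (_ : mkset _ = \big[setI/setT]_(i < n)
    (fun x : V => x 0 i) @^-1` A i).
  apply: bigsetI_measurable => i _; rewrite -[X in measurable X]setTI.
  exact: measurable_rV_coord.
rewrite -bigcap_seq; apply/seteqP; split=> x Ax i; first by move=> _; exact: Ax.
by apply: (Ax i); rewrite /= mem_index_enum.
Qed.

Lemma ball_rVE (c : V) (r : R) : 0 < r ->
  ball c r = [set x | forall i, `]c 0 i - r, c 0 i + r[%classic (x 0 i)].
Proof.
move=> r0; apply/seteqP; split=> x /=.
  move=> [_ cx] i; rewrite in_itv/= -ltr_distl distrC.
  by have := cx 0 i; rewrite -ball_normE.
move=> cx; split => // j i; rewrite -ball_normE/= ord1.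
by have := cx i; rewrite in_itv/= -ltr_distl distrC.
Qed.

Lemma measurable_ball_rV (c : V) (r : R) : 0 < r -> measurable (ball c r).
Proof.
move=> r0; rewrite ball_rVE//.
apply: (@measurable_box (fun i => `]c 0 i - r, c 0 i + r[%classic)) => i.
exact: measurable_itv.
Qed.

Lemma rat_dense_rV (x : V) (r : R) : 0 < r ->
  exists q : 'rV[rat]_n, ball (map_mx ratr q : V) r x.
Proof.
move=> r0; have qP i : exists q : rat, ratr q \in `](x 0 i - r), (x 0 i + r)[.
  by apply: rat_in_itvoo; rewrite ltrD2l (lt_trans _ r0)// oppr_lt0.
exists (\row_i sval (cid (qP i))); rewrite ball_rVE// => i /=.
rewrite !mxE; have := svalP (cid (qP i)); set q := sval _.
by rewrite !in_itv/= => /andP[? ?]; apply/andP; split; lra.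
Qed.

(** Sup-norm balls are boxes, hence measurable for the sigma-algebra generated by the coordinates,
    and countably many balls with rational centres exhaust an open set. *)
Lemma open_measurable_rV U : open U -> measurable U.
Proof.
move=> oU.
(* [k] codes a rational centre and a radius [1 / (m + 1)]; a code whose ball is not inside [U]
   contributes the empty set. *)
pose F (k : nat) : set V := if unpickle k is Some (q, m)
  then (if pselect (ball (map_mx ratr q : V) m.+1%:R^-1 `<=` U) is left _
    then ball (map_mx ratr q : V) m.+1%:R^-1 else set0) else set0.
have -> : U = \bigcup_k F k.
  apply/seteqP; split => [x Ux|x [k _]]; last first.
    rewrite /F; case: unpickle => [[q m]|//].
    by case: pselect => // qU; exact: qU.
  have /nbhs_ballP[e /= e0 eU] : nbhs x U by exact: open_nbhs_nbhs.
  have [m mE] : exists m : nat, m.+1%:R^-1 < e / 2.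
    by have /ltr_add_invr[m] : 0 < e / 2; [exact: divr_gt0|rewrite add0r; exists m].
  have [q qx] := @rat_dense_rV x m.+1%:R^-1 ltac:(by rewrite invr_gt0).
  exists (pickle (q, m)) => //; rewrite /F pickleK; case: pselect => //.
  case=> y qy; apply: eU; apply: (@le_ball _ _ _ (m.+1%:R^-1 + m.+1%:R^-1)).
    by rewrite (splitr e) lerD// ltW.
  exact: ball_triangle (ball_sym qx) qy.
apply: bigcup_measurable => k _; rewrite /F; case: unpickle => [[q m]|//].
by case: pselect => // _; apply: measurable_ball_rV; rewrite invr_gt0.
Qed.

Lemma continuous_measurable_rV D f : open D ->
  (forall x, D x -> {for x, continuous f}) -> measurable_fun D f.
Proof.
move=> oD cf mD; apply: (measurability _ (measurable_realfun.RGenOpens.measurableE R)) => //.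
move=> _ [_ [a [b ->] <-]]; apply: open_measurable_rV.
rewrite openE => x [Dx abx]; apply: filterI; first exact: open_nbhs_nbhs.
apply: (cf x Dx); apply: open_nbhs_nbhs; split => //; exact: interval_open.
Qed.

Lemma bounded_fin_measure D (M : R) : measurable D ->
  (forall x, D x -> `|x| <= M) -> (lebesgue_rV n D < +oo)%E.
Proof.
move=> mD DM.
pose r := `|M| + 1; have r0 : 0 < r by rewrite ltr_wpDl.
have mI : measurable (`]-r, r[ : set (measurableTypeR R)).
  exact: measurable_itv.
have DB : D `<=` [set x : V | forall i, `]-r, r[%classic (x 0 i)].
  move=> x /DM xM i /=; rewrite in_itv/= -ltr_norml.
  apply: (@le_lt_trans _ _ `|x|).
    rewrite [leRHS]/Num.Def.normr/= mx_normrE.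
    exact: (le_bigmax _ (fun ij => `|x ij.1 ij.2|) (0, i)).
  by rewrite (le_lt_trans xM)// /r; apply: le_lt_trans (ler_norm M) _; rewrite ltrDl.
apply: (le_lt_trans (le_measure _ _ _ DB)); rewrite ?inE//.
  exact: (measurable_box (fun _ => mI)).
have := lebesgue_rV_box (fun _ : 'I_n => mI); move=> /= ->.
rewrite lebesgue_measure_itv/= lte_fin ifT; last by lra.
by rewrite -EFinB prodEFin ltry.
Qed.

End rV_borel.

(** * Translation invariance of the Lebesgue measure *)

Section translation.
Context {R : realType}.

Let pushforward_measure d d' (T1 : measurableType d) (T2 : measurableType d')
  (m : {measure set T1 -> \bar R}) (f : T1 -> T2)
  (mf : measurable_fun setT f) : {measure set T2 -> \bar R} :=
  measure_function_pushforward__canonical__measure_function_Measure m mf.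

Lemma measurable_translate1 (c : R) :
  measurable_fun setT ((fun x => x + c) : measurableTypeR R -> measurableTypeR R).
Proof.
apply: continuous_measurable_fun => x.
by apply: continuousD; [exact: id|exact: cst_continuous].
Qed.

Lemma lebesgue_measure_translate (c : R) (A : set (measurableTypeR R)) :
  measurable A ->
  lebesgue_measure ((fun x => x + c) @^-1` A) = lebesgue_measure A.
Proof.
move=> mA; apply/esym.
apply: (@lebesgue_measure_unique R
  (pushforward_measure lebesgue_measure (measurable_translate1 c))) => //.
move=> _ [[a b] _ <-] /=; rewrite /pushforward.
rewrite (_ : _ @^-1` _ = `]a - c, b - c]%classic); last first.
  by apply/seteqP; split => x /=; rewrite !in_itv/= => /andP[? ?];
    apply/andP; split; lra.
rewrite !lebesgue_measure_itv/= !lte_fin ltrD2r.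
by case: ifP => // _; rewrite -!EFinB; congr EFin; lra.
Qed.

Lemma measurable_translate n (c : 'rV[R]_n) :
  measurable_fun setT (fun x : 'rV[R]_n => x + c).
Proof.
apply: measurable_fun_rV => i.
rewrite (_ : (fun _ => _) = (fun y : measurableTypeR R => y + c 0 i) \o
    (fun x : 'rV[R]_n => x 0 i)); last by apply/funext => x; rewrite /= mxE.
by apply: measurableT_comp;
  [exact: measurable_translate1|exact: measurable_rV_coord].
Qed.

(** Induction on the dimension. [S] is the translation read in the product of the first coordinate
    with the remaining ones; it preserves the product measure because it does so on rectangles, by
    the one-dimensional case and the induction hypothesis. *)
Lemma lebesgue_rV_translate n (c : 'rV[R]_n) (A : set 'rV[R]_n) : measurable A ->
  lebesgue_rV n ((fun x => x + c) @^-1` A) = lebesgue_rV n A.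
Proof.
elim: n c A => [|n IH] c A mA.
  rewrite (_ : (fun x => x + c) = id) ?preimage_id//.
  by apply/funext => x; apply/rowP => -[].
pose S (p : measurableTypeR R * 'rV[R]_n) : measurableTypeR R * 'rV[R]_n :=
  (p.1 + c 0 ord0, p.2 + rV_behead c).
have mS : measurable_fun setT S.
  apply/measurable_fun_pairP; split => /=.
  - by apply: (measurableT_comp (measurable_translate1 (c 0 ord0)));
      exact: measurable_fst.
  - by apply: (measurableT_comp (measurable_translate (rV_behead c)));
      exact: measurable_snd.
have mcA : measurable (@rV_cons R n @^-1` A).
  by rewrite -[X in measurable X]setTI; exact: measurable_rV_cons.
rewrite /= /lebesgue_rVS /pushforward.
have SE p : rV_cons (S p) = rV_cons p + c.
  apply/rowP => i; rewrite [RHS]mxE; case: (unliftP ord0 i) => [j|] ->.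
    by rewrite !rV_consS [LHS]mxE; congr (_ + _); rewrite mxE.
  by rewrite !rV_cons0.
have -> : @rV_cons R n @^-1` ((fun x => x + c) @^-1` A) =
    S @^-1` (@rV_cons R n @^-1` A).
  by apply/seteqP; split => p /=; rewrite SE.
pose nu := pushforward_measure (lebesgue_measure \x lebesgue_rV n)%E mS.
suff H X : measurable X -> (lebesgue_measure \x lebesgue_rV n)%E X = nu X.
  by apply/esym; rewrite [LHS]H.
move=> mX; apply: product_measure_unique => //.
move=> B C mB mC /=; rewrite /pushforward.
rewrite (_ : _ @^-1` _ = ((fun x => x + c 0 ord0) @^-1` B) `*`
  ((fun x => x + rV_behead c) @^-1` C))//.
rewrite product_measure1E//=.
- by rewrite IH// lebesgue_measure_translate.
- by rewrite -[X in measurable X]setTI; exact: measurable_translate1.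
- by rewrite -[X in measurable X]setTI; exact: measurable_translate.
Qed.

Lemma Rintegral_translate n (c : 'rV[R]_n) (f : 'rV[R]_n -> R) :
  measurable_fun setT f ->
  (lebesgue_rV n).-integrable setT (EFin \o (fun x => f (x + c))) ->
  \int[lebesgue_rV n]_x f (x + c) = \int[lebesgue_rV n]_x f x.
Proof.
move=> mf fi; rewrite /Rintegral; congr fine.
have := @integral_pushforward _ _ _ _ R _ (measurable_translate c)
  (lebesgue_rV n) setT (EFin \o f).
rewrite preimage_setT => <-//; last exact/measurable_EFinP.
apply: (@eq_measure_integral _ _ _ _ (lebesgue_rV n)
  (pushforward_measure (lebesgue_rV n) (measurable_translate c))).
by move=> A mA _; rewrite /= /pushforward lebesgue_rV_translate.
Qed.

End translation.

Lemma bounded_on (T : Type) (R : realType) (V : normedModType R) (f : T -> V)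
    (K : R) (A : set T) :
  (forall x, A x -> `|f x| <= K) -> [bounded f x | x in A].
Proof.
move=> fK; exists K; split; first exact: num_real.
by move=> N /ltW KN x /fK /le_trans; exact.
Qed.

Lemma bounded_dominated_convergence d (T : measurableType d) (R : realType)
    (mu : {measure set T -> \bar R}) (D : set T) (f_ : nat -> T -> R)
    (f : T -> R) (K : R) :
  measurable D -> (mu D < +oo)%E ->
  (forall n, measurable_fun D (f_ n)) -> measurable_fun D f ->
  (forall n x, D x -> `|f_ n x| <= K) ->
  (forall x, D x -> f_ n x @[n --> \oo] --> f x) ->
  \int[mu]_(x in D) f_ n x @[n --> \oo] --> \int[mu]_(x in D) f x.
Proof.
move=> mD muD mf_ mf fK f_f.
have iK : mu.-integrable D (EFin \o cst K).
  apply: measurable_bounded_integrable => //.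
  exact: (@bounded_on _ _ _ _ `|K|).
have [||||fi _ ] := @dominated_convergence _ _ _ mu D mD
  (fun n => EFin \o f_ n) (EFin \o f) (EFin \o cst K) _ _ _ iK.
- by move=> n; exact/measurable_EFinP.
- exact/measurable_EFinP.
- by apply: aeW => x Dx; apply/fine_cvgP; split; [exact: nearW|exact: f_f].
- by apply: aeW => x n Dx; rewrite lee_fin fK.
rewrite -[X in _ --> X](@fineK _ (\int[mu]_(x in D) (f x)%:E)%E).
  by move=> /fine_cvg.
exact: integrable_fin_num.
Qed.

Lemma continuous_compact_bounded (T : topologicalType) (R : realType)
    (f : T -> R) (A : set T) :
  compact A -> {within A, continuous f} ->
  exists K, forall x, A x -> `|f x| <= K.
Proof.
move=> cA cf; have [M [_ MP]] := compact_bounded (continuous_compact cf cA).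
exists (M + 1) => x Ax; apply: (MP (M + 1)); first by rewrite ltrDl.
by exists x.
Qed.

(** * Continuous functions of compact support and integrals of their differences *)

Section compact_support.
Context {R : realType} {n : nat}.
Local Notation V := 'rV[R]_n.
Local Notation mu := (@lebesgue_rV R n).
Implicit Types (f g : V -> R) (c v : V).

Definition Cc f := continuous f /\ exists M : R, forall x, M < `|x| -> f x = 0.

Lemma compact_closed_ball_rV (M : R) : compact [set x : V | `|x| <= M].
Proof.
apply: bounded_closed_compact.
  exact: (@bounded_on _ _ _ id M).
rewrite (_ : mkset _ = (fun x : V => `|x|) @^-1` [set t | t <= M])//.
apply: closed_comp; last exact: closed_le.
by move=> x _; exact: norm_continuous.
Qed.

Lemma measurable_closed_ball_rV (M : R) : measurable [set x : V | `|x| <= M].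
Proof.
rewrite -[X in measurable X]setCK; apply: measurableC; apply: open_measurable_rV.
apply: closed_openC; apply: compact_closed; first exact: norm_hausdorff.
exact: compact_closed_ball_rV.
Qed.

Lemma Cc_bounded f : Cc f -> exists K, forall x, `|f x| <= K.
Proof.
move=> [cf [M fM]].
have [K KP] := continuous_compact_bounded (@compact_closed_ball_rV M)
  (continuous_subspaceT cf).
exists (Num.max K 0) => x; rewrite le_max.
have [xM|Mx] := leP `|x| M; first by rewrite KP.
by rewrite fM// normr0 lexx orbT.
Qed.

Lemma continuous_measurable_rVT f : continuous f -> measurable_fun setT f.
Proof.
move=> cf; apply: continuous_measurable_rV; first exact: openT.
by move=> x _; exact: cf.
Qed.

Lemma restrict_ball (M : R) f : (forall x, M < `|x| -> f x = 0) ->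
  f \_ [set x : V | `|x| <= M] = f.
Proof.
move=> fM; apply/funext => x; rewrite patchE; case: ifPn => //.
by rewrite notin_setE/= => /negP; rewrite -ltNge => /fM.
Qed.

Lemma Cc_integrable f : Cc f -> mu.-integrable setT (EFin \o f).
Proof.
move=> Cf; have [K fK] := Cc_bounded Cf; have [cf [M fM]] := Cf.
have mB := @measurable_closed_ball_rV M.
rewrite -(restrict_ball fM) -restrict_EFin.
apply: (integrable_mkcond (EFin \o f) mB).1; apply: measurable_bounded_integrable => //.
- by apply: (bounded_fin_measure mB) => x; exact.
- by apply: measurable_funTS; exact: continuous_measurable_rVT.
- exact: (@bounded_on _ _ _ _ K).
Qed.

Lemma CcD f g : Cc f -> Cc g -> Cc (fun x => f x + g x).
Proof.
move=> [cf [M fM]] [cg [N gN]]; split.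
  by move=> x; apply: (@continuousD _ _ _ f g); [exact: cf|exact: cg].
exists (Num.max M N) => x; rewrite gt_max => /andP[/fM-> /gN->].
by rewrite addr0.
Qed.

Lemma CcM f g : Cc f -> continuous g -> Cc (fun x => f x * g x).
Proof.
move=> [cf [M fM]] cg; split.
  by move=> x; apply: (@continuousM _ _ f g); [exact: cf|exact: cg].
by exists M => x /fM ->; rewrite mul0r.
Qed.

Lemma continuous_translate f c : continuous f -> continuous (fun x : V => f (x + c)).
Proof.
move=> cf x; apply: (@continuous_comp _ _ _ (fun x : V => x + c) f); last exact: cf.
apply: (@continuousD _ _ _ (id : V -> V) (cst c)) => //.
exact: cst_continuous.
Qed.

Lemma Cc_translate f c : Cc f -> Cc (fun x => f (x + c)).
Proof.
move=> [cf [M fM]]; split; first exact: continuous_translate.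
exists (M + `|c|) => x Mx; apply: fM.
by have := ler_normB (x + c) c; rewrite addrK; lra.
Qed.

Lemma Cc_difference f c : Cc f -> Cc (fun x => f (x + c) - f x).
Proof.
move=> Cf; apply: CcD; first exact: Cc_translate.
rewrite (_ : (fun _ => _) = fun x => f x * -1).
  by apply: CcM => // x; exact: cst_continuous.
by apply/funext => x; rewrite mulrN1.
Qed.

Lemma Cc_mixed_difference f g (a b : V) : Cc f -> Cc g ->
  Cc (fun x => (f (x + a) - f x) * (g x - g (x - b))).
Proof.
move=> Cf [cg _]; apply: CcM; first exact: Cc_difference.
move=> x; apply: (@continuousB _ _ _ g (fun y : V => g (y - b))).
  exact: cg.
exact: continuous_translate.
Qed.

Lemma Rintegral_difference f c : Cc f -> \int[mu]_x (f (x + c) - f x) = 0.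
Proof.
move=> Cf; rewrite RintegralB//; last 2 first.
- exact: Cc_integrable (Cc_translate c Cf).
- exact: Cc_integrable.
rewrite (Rintegral_translate (c := c)) ?subrr//.
  by apply: continuous_measurable_rVT; exact: Cf.1.
exact: Cc_integrable (Cc_translate c Cf).
Qed.

(* The integrands differ by a sum of three differences h(x + c) - h(x). *)
Lemma Rintegral_mixed_difference f g (a b : V) : Cc f -> Cc g ->
  \int[mu]_x ((f (x + a) - f x) * (g x - g (x - b))) =
  \int[mu]_x ((f (x + b) - f x) * (g x - g (x - a))).
Proof.
move=> Cf Cg; have [cf _] := Cf; have [cg _] := Cg.
pose F1 (x : V) := f x * g (x - a).
pose F2 (x : V) := f (x + a) * g (x - b).
pose F3 (x : V) := f (x + b) * g x.
have CF1 : Cc F1 by apply: CcM => //; exact: continuous_translate.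
have CF2 : Cc F2.
  by apply: CcM; [exact: Cc_translate|exact: continuous_translate].
have CF3 : Cc F3 by apply: CcM => //; exact: Cc_translate.
have CB c h (Ch : Cc h) := Cc_difference c Ch.
have CG := Cc_mixed_difference b a Cf Cg.
pose G x := F1 (x + a) - F1 x +
  ((F2 (x + (b - a)) - F2 x) + (F3 (x - b) - F3 x)).
have CG' : Cc G by apply: CcD; [exact: CB|apply: CcD; exact: CB].
have G0 : \int[mu]_x G x = 0.
  rewrite RintegralD//.
  - rewrite [X in _ + X]RintegralD//; try by apply: Cc_integrable; exact: CB.
    by rewrite !Rintegral_difference// !addr0.
  - by apply: Cc_integrable; exact: CB.
  - by apply: Cc_integrable; apply: CcD; exact: CB.
rewrite -[RHS]addr0 -G0 -RintegralD//; try exact: Cc_integrable.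
apply: eq_Rintegral => x _; rewrite /G /F1 /F2 /F3.
have -> : x + (b - a) + a = x + b by rewrite addrA subrK.
have -> : x + (b - a) - b = x - a by rewrite addrAC addrA subrK.
by rewrite addrK subrK; ring.
Qed.

Lemma Cc_dominated_convergence (f_ : nat -> V -> R) f (M K : R) :
  (forall m, continuous (f_ m)) -> Cc f ->
  (forall m x, M < `|x| -> f_ m x = 0) -> (forall m x, `|f_ m x| <= K) ->
  (forall x, f_ m x @[m --> \oo] --> f x) ->
  \int[mu]_x f_ m x @[m --> \oo] --> \int[mu]_x f x.
Proof.
move=> cf_ [cf [N fN]] f_M f_K f_f.
pose L := Num.max M N.
have f_L m x : L < `|x| -> f_ m x = 0.
  by rewrite gt_max => /andP[/f_M].
have fL x : L < `|x| -> f x = 0 by rewrite gt_max => /andP[_ /fN].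
have mB := @measurable_closed_ball_rV L.
have E g : (forall x, L < `|x| -> g x = 0) ->
    \int[mu]_x g x = \int[mu]_(x in [set x | `|x| <= L]) g x.
  by move=> gL; rewrite [RHS]Rintegral_mkcond restrict_ball.
rewrite E// (_ : (fun m => \int[mu]_x f_ m x) =
  fun m => \int[mu]_(x in [set x | `|x| <= L]) f_ m x); last first.
  by apply/funext => m; apply: E; exact: f_L.
apply: (@bounded_dominated_convergence _ _ R mu _ f_ f K mB).
- by apply: (bounded_fin_measure mB) => x; exact.
- by move=> m; apply: measurable_funTS; exact: continuous_measurable_rVT.
- by apply: measurable_funTS; exact: continuous_measurable_rVT.
- by move=> m x _.
- by move=> x _.
Qed.

End compact_support.

(** * Integration by parts *)

Section integration_by_parts.
Context {R : realType} {n : nat}.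
Local Notation V := 'rV[R]_n.
Local Notation mu := (@lebesgue_rV R n).
Local Notation e_ i := (delta_mx 0 i : V).
Implicit Types (f g : V -> R) (v : V) (D : set V).

Lemma is_derive_seq f x v (d : R) (h : nat -> R) : is_derive x v f d ->
  (forall m, h m != 0) -> h m @[m --> \oo] --> 0 ->
  (f (x + h m *: v) - f x) / h m @[m --> \oo] --> d.
Proof.
move=> [fx fd] h0 hc.
have /cvgr_dnbhsP/(_ h (conj h0 hc)) :
    (f (x + t *: v) - f x) / t @[t --> 0^'] --> d.
  rewrite -fd (_ : (fun t => _) =
    (fun t : R => t^-1 *: ((f \o shift x) (t *: v) - f x))); first exact: fx.
  by apply/funext => t /=; rewrite mulrC (addrC x).
by [].
Qed.

Lemma difference_bounded f (df : V -> R) v (K : R) :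
  (forall x, is_derive x v f (df x)) -> (forall x, `|df x| <= K) ->
  forall x (h : R), h != 0 -> `|(f (x + h *: v) - f x) / h| <= K.
Proof.
move=> fd fK x h h0.
have [c _ ->] := @MVT_line_abs _ _ f df x v h (fun t _ => fd _).
by rewrite mulrC mulKf.
Qed.

Let h_ (m : nat) : R := m.+1%:R^-1.
Let h_gt0 m : 0 < h_ m. Proof. by rewrite invr_gt0. Qed.
Let h_neq0 m : h_ m != 0. Proof. by rewrite gt_eqF. Qed.
Let h_le1 m : h_ m <= 1. Proof. by rewrite invf_le1// ler1n. Qed.
Let h_cvg : h_ m @[m --> \oo] --> 0. Proof. exact: cvg_harmonic. Qed.

Let continuous_fd f v (h : R) : continuous f ->
  continuous (fun x : V => (f (x + h *: v) - f x) / h).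
Proof.
move=> cf x.
apply: (@continuousM _ _ (fun y : V => f (y + h *: v) - f y) (cst h^-1));
  last exact: cst_continuous.
apply: (@continuousB _ _ _ (fun y : V => f (y + h *: v)) f); last exact: cf.
exact: continuous_translate.
Qed.

Lemma Rintegral_partial f (df : V -> R) v : Cc f -> Cc df ->
  (forall x, is_derive x v f (df x)) -> \int[mu]_x df x = 0.
Proof.
move=> Cf Cdf fd; have [cf [M fM]] := Cf; have [K dfK] := Cc_bounded Cdf.
pose f_ m x := (f (x + h_ m *: v) - f x) / h_ m.
have f_cvg : \int[mu]_x f_ m x @[m --> \oo] --> \int[mu]_x df x.
  (* The steps [h_ m] are at most 1, so a translation by [h_ m *: v] enlarges the support by at most
     the norm of [v]. *)
  apply: (@Cc_dominated_convergence _ _ f_ df (M + `|v|) K) => //.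
  - by move=> m; exact: continuous_fd.
  - move=> m x Mx; rewrite /f_ !fM ?subrr ?mul0r//.
      by apply: le_lt_trans Mx; rewrite lerDl.
    have := ler_normB (x + h_ m *: v) (h_ m *: v); rewrite addrK normrZ.
    rewrite gtr0_norm//; have := h_le1 m; have := normr_ge0 v; nra.
  - by move=> m x; exact: difference_bounded fd dfK _ _ (h_neq0 m).
  - by move=> x; exact: is_derive_seq.
have f_0 m : \int[mu]_x f_ m x = 0.
  rewrite RintegralZr//; first by rewrite Rintegral_difference// mul0r.
  exact: Cc_integrable (Cc_difference _ Cf).
rewrite (_ : (fun _ => _) = cst 0) in f_cvg; last exact/funext.
by apply: (cvg_unique _ f_cvg (cvg_cst 0)).
Qed.

(** For smooth functions both sides equal minus the integral of [f] times the mixed derivative of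
    [g]. Here only first derivatives exist, and the mixed second difference, which is symmetric in
    [v] and [w], takes the place of the mixed derivative. *)
Lemma Rintegral_partial2 f g (fv fw gv gw : V -> R) v w :
  Cc f -> Cc g -> Cc fv -> Cc fw -> Cc gv -> Cc gw ->
  (forall x, is_derive x v f (fv x)) -> (forall x, is_derive x w f (fw x)) ->
  (forall x, is_derive x v g (gv x)) -> (forall x, is_derive x w g (gw x)) ->
  \int[mu]_x (fv x * gw x) = \int[mu]_x (fw x * gv x).
Proof.
move=> Cf Cg Cfv Cfw Cgv Cgw fdv fdw gdv gdw.
(* A forward quotient of [f] is paired with a backward quotient of [g]: this is the pairing that
   [Rintegral_mixed_difference] makes symmetric in [v] and [w]. *)
pose F v w m x := ((f (x + h_ m *: v) - f x) / h_ m) *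
  ((g (x + - h_ m *: w) - g x) / - h_ m).
have key v' w' fv' gw' : Cc fv' -> Cc gw' ->
    (forall x, is_derive x v' f (fv' x)) ->
    (forall x, is_derive x w' g (gw' x)) ->
    \int[mu]_x F v' w' m x @[m --> \oo] --> \int[mu]_x (fv' x * gw' x).
  move=> Cf' Cg' df' dg'; have [K fK] := Cc_bounded Cf'.
  have [L gL] := Cc_bounded Cg'; have [cf [M fM]] := Cf; have [cg _] := Cg.
  apply: (@Cc_dominated_convergence _ _ (F v' w') _ (M + `|v'|) (K * L)) => //.
  - move=> m x; apply: (@continuousM _ _
      (fun x : V => (f (x + h_ m *: v') - f x) / h_ m)
      (fun x : V => (g (x + - h_ m *: w') - g x) / - h_ m)); exact: continuous_fd.
  - by apply: CcM => //; exact: Cg'.1.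
  - move=> m x Mx; rewrite /F !fM ?subrr ?mul0r//.
      by apply: le_lt_trans Mx; rewrite lerDl.
    have := ler_normB (x + h_ m *: v') (h_ m *: v'); rewrite addrK normrZ.
    rewrite gtr0_norm//; have := h_le1 m; have := normr_ge0 v'; nra.
  - move=> m x; rewrite /F normrM ler_pM//.
      exact: difference_bounded df' fK _ _ (h_neq0 m).
    by apply: (difference_bounded dg' gL); rewrite oppr_eq0.
  - move=> x; apply: cvgM; first exact: is_derive_seq.
    apply: (@is_derive_seq g x w' (gw' x) (fun m => - h_ m)) => //.
      by move=> m; rewrite oppr_eq0.
    by rewrite -oppr0; exact: cvgN.
have Fvw m : \int[mu]_x F v w m x = \int[mu]_x F w v m x.
  have E v' w' : \int[mu]_x F v' w' m x = \int[mu]_x ((h_ m ^- 2) *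
      ((f (x + h_ m *: v') - f x) * (g x - g (x - h_ m *: w')))).
    apply: eq_Rintegral => x _; rewrite /F scaleNr invrN.
    by rewrite -exprVn; ring.
  rewrite !E !RintegralZl//; first by rewrite Rintegral_mixed_difference.
  - exact: Cc_integrable (Cc_mixed_difference _ _ Cf Cg).
  - exact: Cc_integrable (Cc_mixed_difference _ _ Cf Cg).
have c1 := key v w fv gw Cfv Cgw fdv gdw.
have := key w v fw gv Cfw Cgv fdw gdv.
rewrite (_ : (fun m => \int[mu]_x F w v m x) = fun m => \int[mu]_x F v w m x).
  by move=> c2; exact: (cvg_unique _ c1 c2).
by apply/funext => m; rewrite Fvw.
Qed.

(** On a bounded [D] this says that the support of the restriction of [f] to [D] is a compact subset
    of [D]. The values of [f] off [D] are left free, since the formulas used later involve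
    [1 / rho], which has no meaning there. *)
Definition vanishes_off D f := forall x, ~ D x ->
  \forall y \near x, D y -> f y = 0.

Lemma restrict_vanishes D f x : vanishes_off D f -> ~ D x ->
  \forall y \near x, (f \_ D) y = 0.
Proof.
move=> f0 Dx; have := f0 x Dx; apply: filterS => y fy.
by rewrite patchE; case: ifPn => // /[!inE].
Qed.

Lemma C1_restrict D f df : open D -> C1 D f df -> vanishes_off D f ->
  C1 setT (f \_ D) (fun i => df i \_ D).
Proof.
move=> oD fC f0 x _; have [Dx|nDx] := pselect (D x).
  have DN : \forall y \near x, D y by exact: open_nbhs_nbhs.
  have rE (g : V -> R) : \forall y \near x, g y = (g \_ D) y.
    by near=> y; rewrite patchE mem_set//; near: y.
  have [cf fd] := fC x Dx; split; first exact: near_eq_continuous (rE f) cf.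
  move=> i; have [fi cfi] := fd i; split.
    by rewrite patchE mem_set//; exact: near_eq_is_derive (rE f) fi.
  exact: near_eq_continuous (rE (df i)) cfi.
have fx0 := restrict_vanishes f0 nDx.
split.
  apply: (@near_eq_continuous _ _ (cst 0)); last exact: cst_continuous.
  by apply: filterS fx0 => y ->.
move=> i; split.
  rewrite patchE memNset//; apply: (@near_eq_is_derive _ _ _ (cst 0)).
    by apply: filterS fx0 => y ->.
apply: (@near_eq_continuous _ _ (cst 0)); last exact: cst_continuous.
(* [near_join] provides vanishing on a neighbourhood of each nearby [y], so that the derivative of
   [f] at [y], and not only its value, is 0. *)
have := near_join fx0; apply: filterS => y fy0; rewrite patchE.
case: ifPn => // /[!inE] Dy.
have [_ /(_ i)[dfy _]] := fC y Dy.
have DN : \forall z \near y, D z by exact: open_nbhs_nbhs.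
have d0 : is_derive y (e_ i) f 0.
  apply: (@near_eq_is_derive _ _ _ (cst 0)).
  near=> z; have Dz : D z by near: z.
  have : (f \_ D) z = 0 by near: z.
  by rewrite patchE mem_set.
by rewrite -(@derive_val _ _ _ _ _ _ _ dfy) (@derive_val _ _ _ _ _ _ _ d0).
Unshelve. all: by end_near. Qed.

Lemma C1_Cc D (M : R) f df : (forall x, D x -> `|x| <= M) -> open D ->
  C1 D f df -> vanishes_off D f ->
  Cc (f \_ D) /\ forall i, Cc (df i \_ D).
Proof.
move=> DM oD fC f0; have rC := C1_restrict oD fC f0.
have rM (g : V -> R) x : M < `|x| -> (g \_ D) x = 0.
  by move=> Mx; rewrite patchE memNset// => /DM; rewrite leNgt Mx.
split; first by split; [move=> x; exact: (rC x I).1|exists M; exact: rM].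
by move=> i; split; [move=> x; exact: ((rC x I).2 i).2|exists M; exact: rM].
Qed.

Lemma Rintegral_partial_open D (M : R) f df i :
  (forall x, D x -> `|x| <= M) -> open D ->
  C1 D f df -> vanishes_off D f -> \int[mu]_(x in D) df i x = 0.
Proof.
move=> DM oD fC f0; have rC := C1_restrict oD fC f0.
have [Cf Cdf] := C1_Cc DM oD fC f0.
rewrite Rintegral_mkcond; apply: (Rintegral_partial Cf (Cdf i)) => x.
exact: ((rC x I).2 i).1.
Qed.

Lemma Rintegral_partial2_open D (M : R) f g df dg i j :
  (forall x, D x -> `|x| <= M) -> open D ->
  C1 D f df -> vanishes_off D f -> C1 D g dg -> vanishes_off D g ->
  \int[mu]_(x in D) (df i x * dg j x) = \int[mu]_(x in D) (df j x * dg i x).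
Proof.
move=> DM oD fC f0 gC g0.
have rf := C1_restrict oD fC f0; have rg := C1_restrict oD gC g0.
have [Cf Cdf] := C1_Cc DM oD fC f0; have [Cg Cdg] := C1_Cc DM oD gC g0.
have E (F G : V -> R) : (fun x => F x * G x) \_ D = fun x => (F \_ D) x * (G \_ D) x.
  by apply/funext => x; rewrite !patchE; case: ifP => //; rewrite mulr0.
rewrite Rintegral_mkcond [RHS]Rintegral_mkcond !E.
apply: (Rintegral_partial2 Cf Cg (Cdf i) (Cdf j) (Cdg i) (Cdg j)) => x.
- exact: ((rf x I).2 i).1.
- exact: ((rf x I).2 j).1.
- exact: ((rg x I).2 i).1.
- exact: ((rg x I).2 j).1.
Qed.

End integration_by_parts.

(** * Convex boundary charts *)

Section euclidean_norm.
Context {R : realType} {n : nat}.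
Local Notation V := 'rV[R]_n.
Implicit Types (x y : V).

Lemma sqr_enorm x : enorm x ^+ 2 = \sum_i x 0 i ^+ 2.
Proof. by rewrite sqr_sqrtr// sumr_ge0// => i _; exact: sqr_ge0. Qed.

Lemma enorm_ge0 x : 0 <= enorm x. Proof. exact: sqrtr_ge0. Qed.

Lemma coord_le_enorm x i : `|x 0 i| <= enorm x.
Proof.
rewrite -[leLHS]sqrtr_sqr ler_wsqrtr// (bigD1 i)//= lerDl.
by rewrite sumr_ge0// => j _; exact: sqr_ge0.
Qed.

Lemma norm_le_enorm x : `|x| <= enorm x.
Proof.
rewrite [leLHS]/Num.Def.normr/= mx_normrE; apply/bigmax_leP; split.
  exact: enorm_ge0.
by move=> [i j] _ /=; rewrite ord1; exact: coord_le_enorm.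
Qed.

Lemma enorm_continuous : continuous (@enorm R n).
Proof.
move=> x; apply: (@continuous_comp _ _ _ (fun x : V => \sum_i x 0 i ^+ 2) Num.sqrt);
  last exact: sqrt_continuous.
apply: (@cvg_sumr R _ (nbhs x) _ _ _ xpredT (fun i (y : V) => y 0 i ^+ 2)) => i _.
by apply: (@continuousM _ _ (fun y : V => y 0 i) (fun y : V => y 0 i));
  exact: coord_continuous.
Qed.

Lemma eball_open x (r : R) : open (eball x r).
Proof.
rewrite (_ : eball x r = (fun y => enorm (y + - x)) @^-1` [set t | t < r])//.
apply: open_comp; last exact: open_lt.
by move=> y _; apply: continuous_translate; exact: enorm_continuous.
Qed.

Lemma eball_center x (r : R) : 0 < r -> eball x r x.
Proof.
move=> r0; rewrite /eball/= subrr /enorm big1 ?sqrtr0// => i _.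
by rewrite mxE expr0n.
Qed.

Lemma eball_nbhs x (r : R) : 0 < r -> nbhs x (eball x r).
Proof.
by move=> r0; apply: open_nbhs_nbhs; split; [exact: eball_open|exact: eball_center].
Qed.

Lemma eball_sub_ball x (r : R) : 0 < r -> eball x r `<=` ball x r.
Proof.
move=> r0 y xy; rewrite -ball_normE /ball_/= distrC.
exact: le_lt_trans (norm_le_enorm _) xy.
Qed.

End euclidean_norm.

(** * Regularity up to the closure, read at interior points *)

Section Ckbar_C1.
Context {R : realType} {n : nat}.
Local Notation V := 'rV[R]_n.
Implicit Types (D : set V) (f : V -> R).

Lemma within_closure_continuous (W : normedModType R) D (f : V -> W) x :
  open D -> {within closure D, continuous f} -> D x -> {for x, continuous f}.
Proof.
move=> oD /subspace_continuousP/(_ x) fD Dx.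
have := fD (subset_closure Dx); apply: cvg_trans; apply: cvg_app.
move=> A AN; have DN : \forall y \near x, D y by exact: open_nbhs_nbhs.
suff : \forall y \near x, A y by [].
near=> y; have : closure D y -> A y by near: y.
by apply; apply: subset_closure; near: y.
Unshelve. all: by end_near. Qed.

Lemma Ckbar_continuous (W : normedModType R) k D (f : V -> W) :
  Ckbar k D f -> {within closure D, continuous f}.
Proof. by case: k => [|k] []. Qed.

Lemma Ckbar_partials (W : normedModType R) k D (f : V -> W) : Ckbar k.+1 D f ->
  exists df : 'I_n -> V -> W, forall i, Ckbar k D (df i) /\
    forall x, D x -> is_derive x (delta_mx 0 i) f (df i x).
Proof.
move=> [_ fD].
have H i : exists g, Ckbar k D g /\
    forall x, D x -> is_derive x (delta_mx 0 i) f (g x).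
  have [fd [g [gE gk]]] := fD i; exists g; split => // x Dx.
  by rewrite gE//; apply: DeriveDef => //; exact: fd.
by exists (fun i => sval (cid (H i))) => i; exact: svalP (cid (H i)).
Qed.

Lemma Ckbar_C1 k D f : open D -> Ckbar k.+1 D f ->
  exists df : 'I_n -> V -> R, C1 D f df /\ forall i, Ckbar k D (df i).
Proof.
move=> oD fk; have [df dfP] := Ckbar_partials fk.
exists df; split => [x Dx|i]; last exact: (dfP i).1.
split; first exact: within_closure_continuous (Ckbar_continuous fk) Dx.
move=> i; have [dfk dfx] := dfP i; split; first exact: dfx.
exact: within_closure_continuous (Ckbar_continuous dfk) Dx.
Qed.

Lemma Ckbar_le k l D f : (k <= l)%N -> Ckbar l D f -> Ckbar k D f.
Proof.
elim: k l f => [|k IH] [|l] f //= kl [fc fl]; split => // i.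
have [fd [g [gE gl]]] := fl i; split => //; exists g; split => //.
exact: IH gl.
Qed.

End Ckbar_C1.

(** * The defining function of a graph *)

Section graph_function.
Context {R : realType} {n : nat}.
Local Notation V := 'rV[R]_n.

Lemma col'_continuous (i : 'I_n) : continuous (fun x : V => col' i x).
Proof.
move=> x A /nbhs_ballP[e /= e0 eA]; apply/nbhs_ballP; exists e => // y [_ xy].
by apply: eA; split => // j k; rewrite !mxE; exact: xy.
Qed.

Lemma C1_col' (i : 'I_n) (psi : 'rV[R]_n.-1 -> R) dpsi : C1 setT psi dpsi ->
  C1 setT (fun x : V => psi (col' i x))
    (fun j x => if unlift i j is Some k then dpsi k (col' i x) else 0).
Proof.
move=> psiC x _.
have c (g : 'rV[R]_n.-1 -> R) : {for col' i x, continuous g} ->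
    {for x, continuous (fun y : V => g (col' i y))}.
  move=> cg.
  exact: (@continuous_comp _ _ _ (fun y : V => col' i y) g x
    (@col'_continuous i x) cg).
have [cpsi dP] := psiC (col' i x) I; split; first exact: c.
move=> j; case: unliftP => [k ->|->].
  have [pk cpk] := dP k; split; last exact: c.
  apply/is_derive_line0; move/is_derive_line0 : pk.
  have -> : (fun t => psi (col' i (x + t *: delta_mx 0 (lift i k)))) =
      fun t => psi (col' i x + t *: delta_mx 0 k).
    apply/funext => t; congr psi; apply/rowP => l; rewrite !mxE.
    by rewrite !eqxx/= (inj_eq lift_inj).
  exact.
split; last exact: cst_continuous.
apply/is_derive_line0; rewrite (_ : (fun _ => _) = cst (psi (col' i x))).
  exact: is_derive_cst.
apply/funext => t; congr psi; apply/rowP => l; rewrite !mxE.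
by rewrite [lift i l == i]eq_sym (negbTE (neq_lift _ _)) andbF mulr0 addr0.
Qed.

Variables (i : 'I_n) (b : bool) (psi : 'rV[R]_n.-1 -> R).

Definition graph_fun (x : V) := psi (col' i x) - (-1) ^+ b * x 0 i.

(** The inward axis direction: along it [graph_fun] decreases at unit speed. *)
Definition graph_axis : V := (-1) ^+ b *: delta_mx 0 i.

Lemma signr_sqr : (-1) ^+ b * (-1) ^+ b = 1 :> R.
Proof. by rewrite -expr2 sqrr_sign. Qed.

Lemma graph_fun_axis x (t : R) : graph_fun (x + t *: graph_axis) = graph_fun x - t.
Proof.
rewrite /graph_fun (_ : col' i (x + _) = col' i x); last first.
  by apply/rowP => l; rewrite !mxE [lift i l == i]eq_sym (negbTE (neq_lift _ _)) andbF !mulr0 addr0.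
by rewrite !mxE !eqxx mulr1 mulrDr mulrCA signr_sqr mulr1 opprD addrA.
Qed.

(** The last clause keeps the gradient away from 0, so that it can be normalised to a normal
    vector. *)
Lemma graph_fun_C2 : Ckbar 2 setT psi -> exists drho d2rho,
  [/\ C1 setT graph_fun drho, forall j, C1 setT (drho j) (d2rho j) &
  forall x, drho i x = - (-1) ^+ b].
Proof.
move=> psi2; have [dpsi [psiC dpsi1]] := Ckbar_C1 openT psi2.
have [d2psi d2P] : exists d2psi : 'I_n.-1 -> 'I_n.-1 -> _ -> R,
    forall k, C1 setT (dpsi k) (d2psi k).
  have H k := Ckbar_C1 openT (dpsi1 k).
  exists (fun k => sval (cid (H k))) => k.
  by have [] := svalP (cid (H k)).
exists (fun j x => (if unlift i j is Some k then dpsi k (col' i x) else 0) -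
  (-1) ^+ b * (j == i)%:R).
exists (fun j l x => if unlift i j is Some k then
  (if unlift i l is Some m then d2psi k m (col' i x) else 0) else 0).
have CM := C1M (@C1_cst R n setT (- (-1) ^+ b)) (C1_coord i).
split.
- have := C1D (C1_col' i psiC) CM; apply: C1_eq => [|x _|x _ j].
  + exact: openT.
  + by rewrite /graph_fun mulNr.
  + by rewrite mul0r add0r /cst mulNr.
- move=> j; case: unliftP => [k _|_].
    have := C1D (C1_col' i (d2P k)) (@C1_cst R n setT (- ((-1) ^+ b * (j == i)%:R))).
    by apply: C1_eq => [|//|x _ l]; [exact: openT|rewrite addr0].
  have := @C1_cst R n setT (0 - ((-1) ^+ b * (j == i)%:R)).
  by apply: C1_eq => //; exact: openT.
- by move=> x; rewrite unlift_none eqxx mulr1 sub0r.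
Qed.

End graph_function.

Lemma near_line (R : realType) (V : normedModType R) (p v : V) (P : V -> Prop) :
  (\forall q \near p, P q) ->
  exists2 t0 : R, 0 < t0 & forall t, `|t| <= t0 -> P (p + t *: v).
Proof.
move=> /(near_line2 v 0)[t0 t00 tP]; exists t0 => // t tt0.
by have := tP t 0 tt0; rewrite normr0 (ltW t00) scaler0 addr0; exact.
Qed.

Lemma convex_set_midpoint (R : realType) (V : lmodType R) (A : set V) (p q : V) :
  convex_set A -> A p -> A q -> A (2^-1 *: (p + q)).
Proof.
move=> cA Ap Aq; have h0 : 0 <= (2^-1 : R) by rewrite invr_ge0.
have h1 : 2^-1 <= 1 :> R by rewrite invf_le1// ler1n.
have := cA p q (Itv01 h0 h1) (mem_set Ap) (mem_set Aq); rewrite inE.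
suff -> : conv (Itv01 h0 h1) (p : convex_lmodType V) q = 2^-1 *: (p + q) by [].
rewrite scalerDr; congr (_ + _ *: _); rewrite -[LHS]/(1 - 2^-1 : R).
lra.
Qed.

(** * Convexity of the domain gives convexity of its defining function *)

Section local_graph.
Context {R : realType} {n : nat}.
Local Notation V := 'rV[R]_n.
Variables (Omega : set V) (y : V) (s : R) (i : 'I_n) (b : bool)
  (psi : 'rV[R]_n.-1 -> R).
Hypotheses (oOmega : open Omega) (cOmega : convex_set Omega)
  (graph2 : local_graph 2 Omega y s i b psi).

Let rho := graph_fun i b psi.
Let e := @graph_axis R n i b.

Lemma local_graphE x : eball y s x -> Omega x <-> rho x < 0.
Proof.
case: graph2 => s0 _ /seteqP[OB BO] yx; rewrite /rho /graph_fun subr_lt0; split.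
  by move=> Ox; have [] := OB x (conj Ox yx).
by move=> rx; have [] := BO x (conj rx yx).
Qed.

Lemma graph_fun_continuous : continuous rho.
Proof.
have [_ psi2 _] := graph2; have [drho [_ [rC _ _]]] := graph_fun_C2 i b psi2.
by move=> x; have [] := rC x I.
Qed.

Lemma graph_fun_boundary x : eball y s x -> boundary Omega x -> rho x = 0.
Proof.
move=> yx [clx intx].
have BN : \forall z \near x, eball y s z.
  by apply: open_nbhs_nbhs; split => //; exact: eball_open.
apply/eqP; case: ltgtP => // [rx|rx]; exfalso.
  apply: intx; apply: open_nbhs_nbhs; split => //.
  exact/(local_graphE yx).
have rN : \forall z \near x, 0 < rho z.
  exact: (graph_fun_continuous (lt_nbhsr rx)).
have [z [Oz [yz rz]]] := clx _ (filterI BN rN).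
by have /(local_graphE yz) := Oz; rewrite ltNge (ltW rz).
Qed.

(** Convexity of [Omega] speaks directly only of the graph [rho = 0]. Since [rho] is affine along
    [e], it is transported to other points: [w + rho w *: e] is the point of the graph on the axis
    line through [w], and the midpoint of two such points, pushed slightly inwards, stays in
    [Omega]. Hence it is the graph point of [x] that has to lie in the chart ball. *)
Lemma graph_fun_midpoint x v : eball y s (x + rho x *: e) ->
  exists2 t0 : R, 0 < t0 & forall t, `|t| <= t0 ->
    2 * rho x <= rho (x + t *: v) + rho (x - t *: v).
Proof.
set z := x + rho x *: e => yz.
have eball_near p : eball y s p -> \forall q \near p, eball y s q.
  by move=> yp; apply: open_nbhs_nbhs; split => //; exact: eball_open.
have /nbhs_ballP[r /= r0 rB] := eball_near z yz.
have c1 : {for x, continuous (fun w : V => w + rho w *: e)}.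
  apply: (@continuousD _ _ _ id (fun w : V => rho w *: e)); first by move=> A.
  apply: (@continuousZr_tmp _ _ _ rho); exact: graph_fun_continuous.
have c2 : {for x, continuous (fun w : V => x + rho w *: e)}.
  apply: (@continuousD _ _ _ (cst x) (fun w : V => rho w *: e)).
    exact: cst_continuous.
  apply: (@continuousZr_tmp _ _ _ rho); exact: graph_fun_continuous.
have N1 : \forall w \near x, eball y s (w + rho w *: e) := c1 _ (eball_near z yz).
have N2 : \forall w \near x, ball z r (x + rho w *: e) := c2 _ (nbhsx_ballx z r r0).
have [t0 t00 tP] := near_line v (filterI N1 N2).
exists t0 => // t tt0.
have [p1 q1] := tP t tt0.
have := tP (- t); rewrite normrN scaleNr => /(_ tt0)[p2 q2].
set w1 := x + t *: v in p1 q1 *; set w2 := x - t *: v in p2 q2 *.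
pose a := 2^-1 * (rho w1 + rho w2).
have pa : eball y s (x + a *: e).
  apply: rB; rewrite -ball_normE /ball_/= in q1 q2 *.
  rewrite (_ : z - _ = 2^-1 *: ((z - (x + rho w1 *: e)) + (z - (x + rho w2 *: e)))).
    rewrite normrZ ger0_norm ?invr_ge0//.
    have := ler_normD (z - (x + rho w1 *: e)) (z - (x + rho w2 *: e)); lra.
  rewrite /a /z -scalerA scalerDl; apply/rowP => l; rewrite !mxE; lra.
have [d1 d10 dP1] := near_line e (eball_near _ p1).
have [d2 d20 dP2] := near_line e (eball_near _ p2).
have [d3 d30 dP3] := near_line e (eball_near _ pa).
suff : rho x <= a by rewrite /a; lra.
apply/ler_addgt0Pr => eps eps0.
(* The graph points themselves lie outside the open set [Omega]; a further step [dl] along [e]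
   brings them inside, while both points and their midpoint stay in the chart ball. *)
pose dl := Num.min eps (Num.min d1 (Num.min d2 d3)).
have dl0 : 0 < dl by rewrite !lt_min eps0 d10 d20 d30.
have [dle dl1 dl2 dl3] : [/\ dl <= eps, `|dl| <= d1, `|dl| <= d2 & `|dl| <= d3].
  rewrite gtr0_norm// /dl; split; first by rewrite ge_min lexx.
  - by rewrite !ge_min lexx !orbT.
  - by rewrite !ge_min lexx !orbT.
  - by rewrite !ge_min lexx !orbT.
have Om w : eball y s (w + rho w *: e + dl *: e) -> Omega (w + rho w *: e + dl *: e).
  move=> yw; apply/(local_graphE yw); rewrite /rho !graph_fun_axis; lra.
have := convex_set_midpoint cOmega (Om _ (dP1 _ dl1)) (Om _ (dP2 _ dl2)).
rewrite (_ : 2^-1 *: _ = x + a *: e + dl *: e); last first.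
  by rewrite /w1 /w2 /a; apply/rowP => l; rewrite !mxE; lra.
move/(local_graphE (dP3 _ dl3)); rewrite /rho !graph_fun_axis -/rho; lra.
Qed.

(** If the second derivative [Q] along [v] were negative at [x], it would be so nearby, and by
    [MVT_mixed] the symmetric second difference of [rho] would be negative, against
    [graph_fun_midpoint]. *)
Lemma graph_fun_convex (drho : 'I_n -> V -> R) (d2rho : 'I_n -> 'I_n -> V -> R)
    (x v : V) : C1 setT rho drho -> (forall j, C1 setT (drho j) (d2rho j)) ->
  eball y s (x + rho x *: e) ->
  0 <= \sum_j v 0 j * \sum_k v 0 k * d2rho k j x.
Proof.
move=> rC r2C yz.
pose G w := \sum_k v 0 k * drho k w.
pose dG j w := \sum_k v 0 k * d2rho k j w.
have GC : C1 setT G dG.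
  have H k : C1 setT (fun w => v 0 k * drho k w) (fun j w => v 0 k * d2rho k j w).
    have := C1M (@C1_cst R n setT (v 0 k)) (r2C k).
    by apply: C1_eq => //; [exact: openT|move=> w _ j; rewrite mul0r add0r].
  exact: (C1_sum H).
pose Q w := \sum_j v 0 j * dG j w.
have Gv w : is_derive w v rho (G w) by exact: is_derive_C1 openT rC I.
have Qv w : is_derive w v G (Q w) by exact: is_derive_C1 openT GC I.
have cQ : {for x, continuous Q}.
  apply: (@cvg_sumr R _ (nbhs x) _ _ _ xpredT (fun j w => v 0 j * dG j w)) => j _.
  apply: (@cvgM _ _ (nbhs x) _ (cst (v 0 j)) (dG j)); first exact: cvg_cst.
  exact: ((GC x I).2 j).2.
rewrite leNgt; apply/negP => Q0.
have QN : \forall w \near x, Q w < 0 by exact: (cQ _ (lt_nbhsl Q0)).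
have [t0 t00 tP] := near_line v QN.
have [t1 t10 tP1] := graph_fun_midpoint v yz.
(* [Q] is evaluated at [x + (a + c - t) *: v] with [a] and [c] at most [t] in absolute value, hence
   the factor 3. *)
pose t := Num.min (t0 / 3) t1.
have tt : 0 < t by rewrite lt_min t10 divr_gt0.
have [t_t0 t_t1] : t <= t0 / 3 /\ t <= t1 by rewrite /t !ge_min !lexx orbT.
have [|a [c [at_ ct E]]] := @MVT_mixed R V rho G Q (x - t *: v) v v t tt.
  by move=> ? ? _ _ /=; split.
have : Q (x - t *: v + a *: v + c *: v) < 0.
  rewrite -scaleNr -!addrA -!scalerDl; apply: tP.
  have := ler_normD (- t) (a + c); have := ler_normD a c.
  rewrite normrN (gtr0_norm tt); lra.
move: E; rewrite subrK => E.
have := tP1 t; rewrite (gtr0_norm tt) => /(_ t_t1).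
set q := Q _ in E *; move=> m q0.
have : 0 <= t * (t * q) by rewrite -E; lra.
by rewrite !pmulr_rge0// leNgt q0.
Qed.

End local_graph.

(** * Convex charts of a uniform radius *)

Section convex_chart.
Context {R : realType} {n : nat}.
Local Notation V := 'rV[R]_n.
Implicit Types (Omega : set V) (x y v : V).

(** [rho] is defined on the whole space, but describes [Omega] and is known to be convex only in the
    ball. In [chart_normal] the factor [c] is left free: the boundary condition is homogeneous in
    the normal, so only its direction matters. *)
Record convex_chart Omega x0 (r : R) (i : 'I_n) (b : bool) (rho : V -> R)
    (drho : 'I_n -> V -> R) (d2rho : 'I_n -> 'I_n -> V -> R) : Prop := {
  chart_C1 : C1 setT rho drho ;
  chart_C2 : forall j, C1 setT (drho j) (d2rho j) ;
  chart_axis : forall x (t : R), rho (x + t *: graph_axis i b) = rho x - t ;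
  chart_in : forall x, eball x0 r x -> Omega x <-> rho x < 0 ;
  chart_convex : forall x v, eball x0 r x ->
    0 <= \sum_j v 0 j * \sum_k v 0 k * d2rho k j x ;
  chart_normal : forall y, Iset Omega x0 r y -> exists2 c : R, c != 0 &
    outward_unit_normal Omega y (c *: \row_j drho j y) }.

Lemma local_graph_normal Omega y (s : R) i b psi drho y' :
  local_graph 2 Omega y s i b psi -> C1 setT (graph_fun i b psi) drho ->
  (forall x, drho i x = - (-1) ^+ b) ->
  eball y s y' -> boundary Omega y' ->
  exists2 c : R, c != 0 & outward_unit_normal Omega y' (c *: \row_j drho j y').
Proof.
move=> [s0 psi2 OE] rC drhoi yy' by'.
have gradE : grad (graph_fun i b psi) y' = \row_j drho j y'.
  apply/rowP => j; rewrite !mxE /partial.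
  by have [_ /(_ j)[[_ ->]]] := rC y' I.
have e0 : enorm (\row_j drho j y') != 0.
  apply: contraTneq (coord_le_enorm (\row_j drho j y') i) => ->.
  by rewrite mxE drhoi normrN normr_sign ler10.
exists (enorm (\row_j drho j y'))^-1; first by rewrite invr_eq0.
(* [outward_unit_normal] refers to a graph in a ball centred at the point itself, so the same graph
   is used in a smaller ball around [y']. *)
have /nbhs_ballP[s' /= s'0 s's] : nbhs y' (eball y s).
  by apply: open_nbhs_nbhs; split => //; exact: eball_open.
have sub := subset_trans (@eball_sub_ball R n y' s' s'0) s's.
exists s', i, b, psi; split; last by rewrite /= -gradE.
split => //; first exact: Ckbar_le psi2.
rewrite -(setIidr sub) (setIC (eball y s)) !setIA; apply/seteqP.
split=> x [[Ax y'x] yx]; split => //; split => //.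
  have : (Omega `&` eball y s) x by [].
  by rewrite OE => -[].
have : ([set x | psi (col' i x) < (-1) ^+ b * x 0 i] `&` eball y s) x by [].
by rewrite -OE => -[].
Qed.

(** Compactness of the boundary turns the charts around single points into charts of one radius
    around every boundary point. This is the origin of [r0], which thus depends on [Omega] only. *)
Lemma convex_chart_exists Omega : open Omega -> bounded_set Omega ->
  convex_set Omega -> Ck_boundary 2 Omega ->
  exists2 r0 : R, 0 < r0 & forall x0 (r : R), boundary Omega x0 ->
    0 < r -> r < r0 ->
    exists i b rho drho d2rho, convex_chart Omega x0 (2 * r) i b rho drho d2rho.
Proof.
move=> oO [M [_ bO]] cO kO.
have cB : compact (boundary Omega).
  apply: bounded_closed_compact.
    apply: (@bounded_on _ _ _ id (M + 1)) => x [clx _].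
    have : closure [set z : V | `|z| <= M + 1] x.
      by apply: closure_subset clx => z Oz; apply: (bO (M + 1)) => //; rewrite ltrDl.
    have cl := compact_closed (@norm_hausdorff _ _) (@compact_closed_ball_rV R n (M + 1)).
    by rewrite -(closure_id _).1.
  rewrite /boundary setDE; apply: closedI; first exact: closed_closure.
  exact/open_closedC/open_interior.
pose P (r : R) x := 0 < r -> exists i b rho drho d2rho,
  convex_chart Omega x (2 * r) i b rho drho d2rho.
have : \forall r \near 0^'+, boundary Omega `<=` P r.
  have /compact_near_coveringP/(_ R 0^'+ P _) := cB; apply=> x Bx.
  have [s [i [b [psi lg]]]] := kO x Bx.
  have [s0 psi2 _] := lg.
  have [drho [d2rho [rC r2C drhoi]]] := graph_fun_C2 i b psi2.
  pose rho := graph_fun i b psi.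
  have rx : rho x = 0 by exact: (graph_fun_boundary oO lg (eball_center _ s0) Bx).
  have c1 : {for x, continuous (fun w : V => w + rho w *: graph_axis i b)}.
    apply: (@continuousD _ _ _ id (fun w : V => rho w *: graph_axis i b)).
      by move=> A.
    by apply: (@continuousZr_tmp _ _ _ rho); exact: (rC x I).1.
  (* As [rho x = 0], the projection onto the graph along the axis fixes [x]; by continuity it maps a
     neighbourhood of [x] into the chart ball, as [graph_fun_convex] requires. *)
  have N1 : \forall w \near x, eball x s (w + rho w *: graph_axis i b).
    by apply: c1; rewrite rx scale0r addr0; exact: eball_nbhs.
  have N2 : \forall w \near x, eball x s w by exact: eball_nbhs.
  have /nbhs_ballP[e /= e0 eP] : nbhs x
      [set w | eball x s (w + rho w *: graph_axis i b) /\ eball x s w].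
    exact: filterI N1 N2.
  have nbhs_r : \forall r \near 0^'+, 2 * r <= e / 2.
    near=> t; have : t < e / 4 by near: t; apply: nbhs_right_lt; rewrite divr_gt0.
    lra.
  near=> x' r => r0; exists i, b, rho, drho, d2rho.
  have xx' : ball x (e / 2) x' by near: x'; apply: nbhsx_ballx; rewrite divr_gt0.
  have re : 2 * r <= e / 2 by near: r; exact: nbhs_r.
  have sub : eball x' (2 * r) `<=` ball x e.
    have r2 : 0 < 2 * r by rewrite mulr_gt0.
    apply: subset_trans (eball_sub_ball r2) _ => z x'z.
    apply: (@le_ball _ _ _ (e / 2 + 2 * r)); first by rewrite [leRHS]splitr lerD2l.
    exact: ball_triangle xx' x'z.
  split => //.
  - by move=> z t; exact: graph_fun_axis.
  - by move=> z /sub/eP[_ zs]; exact: (local_graphE lg).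
  - move=> z v /sub/eP[zs _].
    exact: (graph_fun_convex cO lg v rC r2C zs).
  - move=> z [/sub/eP[_ zs] Bz]; exact: (local_graph_normal lg rC drhoi zs Bz).
move=> [e /= e0 eP]; exists e => // x0 r Bx r0 re.
apply: (eP r) => //=; by rewrite sub0r normrN gtr0_norm.
Unshelve. all: by end_near. Qed.

End convex_chart.

(** * Divergence-free fields and the singular cutoff *)

Lemma integrable_sumr d (T : measurableType d) (R : realType)
    (mu : {measure set T -> \bar R}) (D : set T) (I : Type) (r : seq I)
    (f : I -> T -> R) : measurable D ->
  (forall i, mu.-integrable D (EFin \o f i)) ->
  mu.-integrable D (EFin \o (fun x => \sum_(i <- r) f i x)).
Proof.
move=> mD fi; have := @integrable_sum _ _ _ mu D mD I r xpredT _ (fun i _ => fi i).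
by apply: eq_integrable => // x _; rewrite /= sumEFin.
Qed.

Lemma Rintegral_sumr d (T : measurableType d) (R : realType)
    (mu : {measure set T -> \bar R}) (D : set T) (I : Type) (r : seq I)
    (f : I -> T -> R) : measurable D ->
  (forall i, mu.-integrable D (EFin \o f i)) ->
  \int[mu]_(x in D) (\sum_(i <- r) f i x) = \sum_(i <- r) \int[mu]_(x in D) f i x.
Proof.
move=> mD fi; elim: r => [|i r IH].
  rewrite big_nil (_ : (fun _ => _) = cst 0) ?Rintegral_cst ?mul0r//.
  by apply/funext => x; rewrite big_nil.
rewrite big_cons -IH -RintegralD//; last exact: integrable_sumr.
by apply: eq_Rintegral => x _; rewrite big_cons.
Qed.

Section divergence_free.
Context {R : realType} {n : nat}.
Local Notation V := 'rV[R]_n.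
Local Notation mu := (@lebesgue_rV R n).
Variables (D : set V) (M : R).
Hypotheses (oD : open D) (DM : forall x, D x -> `|x| <= M).
Implicit Types (f g s m : V -> R).

Let mD : measurable D. Proof. exact: open_measurable_rV. Qed.

Lemma vanishes_offM f g : vanishes_off D f -> vanishes_off D (fun x => f x * g x).
Proof.
move=> f0 x Dx; have := f0 x Dx; apply: filterS => y fy /fy ->.
by rewrite mul0r.
Qed.

Lemma integrable_bounded_open f (K : R) :
  (forall x, D x -> {for x, continuous f}) -> (forall x, D x -> `|f x| <= K) ->
  mu.-integrable D (EFin \o f).
Proof.
move=> cf fK; apply: measurable_bounded_integrable => //.
- exact: bounded_fin_measure DM.
- exact: continuous_measurable_rV.
- exact: bounded_on fK.
Qed.

Lemma integrable_partial f df i : C1 D f df -> vanishes_off D f ->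
  mu.-integrable D (EFin \o df i).
Proof.
move=> fC f0; have [_ /(_ i) Cdf] := C1_Cc DM oD fC f0.
apply/integrable_mkcond => //.
by rewrite restrict_EFin; exact: Cc_integrable.
Qed.

Lemma integrable_partial2 f g df dg i j : C1 D f df -> vanishes_off D f ->
  C1 D g dg -> vanishes_off D g ->
  mu.-integrable D (EFin \o (fun x => df i x * dg j x)).
Proof.
move=> fC f0 gC g0; have [_ /(_ i) Cdf] := C1_Cc DM oD fC f0.
have [_ /(_ j) Cdg] := C1_Cc DM oD gC g0.
have K1 x : D x -> (df i \_ D) x = df i x by move=> Dx; rewrite patchE mem_set.
have K2 x : D x -> (dg j \_ D) x = dg j x by move=> Dx; rewrite patchE mem_set.
have [K dfK] := Cc_bounded Cdf; have [L dgL] := Cc_bounded Cdg.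
apply: (@integrable_bounded_open _ (K * L)) => x Dx.
  apply: (@continuousM _ _ (df i) (dg j)).
    exact: ((fC x Dx).2 i).2.
  exact: ((gC x Dx).2 j).2.
rewrite normrM ler_pM//.
  by rewrite -K1.
by rewrite -K2.
Qed.

Variables (F : 'I_n -> V -> R) (dF : 'I_n -> 'I_n -> V -> R).
Hypotheses (FC : forall j, C1 D (F j) (fun i => dF i j))
  (divF : forall x, D x -> \sum_j dF j j x = 0).

(** [dF i j] is the i-th partial derivative of [F j]. For [A = s F] this is the sum of
    [d_i A_j d_j A_i - d_j A_j d_i A_i], simplified by [div F = 0]. *)
Definition quad_form s (ds : 'I_n -> V -> R) (x : V) :=
  s x ^+ 2 * (\sum_i \sum_j dF i j x * dF j i x) +
  \sum_i \sum_j (2 * s x * ds i x) * F j x * dF j i x.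

(** Each [Q i j] integrates to 0 by the exchange of derivatives. In the sum the two copies of
    [(F . grad s)^2] cancel, the terms containing [div F] vanish, and the two remaining cross terms
    coincide after renaming the indices. *)
Lemma quad_form_integral s ds : C1 D s ds -> vanishes_off D s ->
  mu.-integrable D (EFin \o quad_form s ds) /\
  \int[mu]_(x in D) quad_form s ds x = 0.
Proof.
move=> sC s0.
pose A j x := s x * F j x.
pose dA j i x := ds i x * F j x + s x * dF i j x.
have AC j : C1 D (A j) (dA j) by exact: C1M.
have A0 j : vanishes_off D (A j) by exact: vanishes_offM.
pose Q i j x := dA j i x * dA i j x - dA j j x * dA i i x.
have Qi i j : mu.-integrable D (EFin \o Q i j).
  have := integrableB mD (integrable_partial2 i j (AC j) (A0 j) (AC i) (A0 i))
    (integrable_partial2 j i (AC j) (A0 j) (AC i) (A0 i)).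
  by apply: eq_integrable.
have Q0 i j : \int[mu]_(x in D) Q i j x = 0.
  rewrite RintegralB//; try exact: integrable_partial2.
  rewrite (Rintegral_partial2_open i j DM oD (AC j) (A0 j) (AC i) (A0 i)).
  by rewrite subrr.
have QE x : D x -> \sum_i \sum_j Q i j x = quad_form s ds x.
  move=> Dx; rewrite /quad_form.
  have e1 : \sum_i \sum_j ds j x * F i x * dF i j x =
      \sum_i \sum_j ds i x * F j x * dF j i x by rewrite exchange_big.
  have e2 (a : 'I_n -> R) : \sum_i \sum_j a j * dF i i x = 0.
    rewrite exchange_big big1// => j _.
    by rewrite -mulr_sumr divF// mulr0.
  have e3 : \sum_i \sum_j ds i x * F i x * dF j j x = 0.
    by rewrite exchange_big e2.
  transitivity (s x ^+ 2 * (\sum_i \sum_j dF i j x * dF j i x) +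
      s x * (\sum_i \sum_j ds i x * F j x * dF j i x) +
      s x * (\sum_i \sum_j ds j x * F i x * dF i j x) -
      s x * (\sum_i \sum_j (ds j x * F j x) * dF i i x) -
      s x * (\sum_i \sum_j ds i x * F i x * dF j j x) -
      s x ^+ 2 * (\sum_i \sum_j dF j j x * dF i i x)).
    rewrite -!mulrN -!sumrN !mulr_sumr -!big_split/=; apply: eq_bigr => i _.
    rewrite -!sumrN !mulr_sumr -!big_split/=; apply: eq_bigr => j _.
    by rewrite /Q /dA; ring.
  rewrite e1 e2 (e2 (fun j => dF j j x)) e3 !mulr0 !subr0 -addrA; congr (_ + _).
  set X := \sum_i _; have -> : s x * X + s x * X = (2 * s x) * X by ring.
  rewrite mulr_sumr; apply: eq_bigr => i _; rewrite mulr_sumr; apply: eq_bigr => j _; ring.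
have Qi' i : mu.-integrable D (EFin \o (fun x => \sum_j Q i j x)).
  exact: integrable_sumr.
split.
  apply: (@eq_integrable _ _ _ mu D mD (EFin \o (fun x => \sum_i \sum_j Q i j x))).
    by move=> x /[!inE] Dx; rewrite /= QE.
  exact: integrable_sumr.
transitivity (\int[mu]_(x in D) (\sum_i \sum_j Q i j x)).
  by apply: eq_Rintegral => x /[!inE] Dx; rewrite QE.
rewrite Rintegral_sumr// big1// => i _.
by rewrite Rintegral_sumr// big1.
Qed.

(** [I] is the divergence of the field [m g F], because [F] is divergence free. *)
Lemma transport_integral m dm g dg : C1 D m dm -> vanishes_off D m ->
  C1 D g dg ->
  let I x := m x * (\sum_j F j x * dg j x) + g x * (\sum_j F j x * dm j x) in
  mu.-integrable D (EFin \o I) /\ \int[mu]_(x in D) I x = 0.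
Proof.
move=> mC m0 gC I.
have BC j := C1M (C1M mC (FC j)) gC.
have B0 j : vanishes_off D (fun x => m x * F j x * g x).
  by do 2!apply: vanishes_offM.
have Bi j := integrable_partial j (BC j) (B0 j).
have BI j := Rintegral_partial_open j DM oD (BC j) (B0 j).
have IE x : D x -> I x = \sum_j ((dm j x * F j x + m x * dF j j x) * g x +
    m x * F j x * dg j x).
  move=> Dx; transitivity (I x + m x * g x * \sum_j dF j j x).
    by rewrite divF// mulr0 addr0.
  rewrite /I !mulr_sumr -!big_split/=; apply: eq_bigr => j _; ring.
split.
  apply: (eq_integrable mD) (integrable_sumr _ mD Bi) => x /[!inE] Dx.
  by rewrite /= IE.
transitivity (\int[mu]_(x in D) \sum_j ((dm j x * F j x + m x * dF j j x) * g x +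
    m x * F j x * dg j x)).
  by apply: eq_Rintegral => x /[!inE] Dx; rewrite IE.
by rewrite Rintegral_sumr// big1.
Qed.

End divergence_free.

Section continuity_on.
Context {R : realType} {T : topologicalType}.
Implicit Types (D : set T) (f g : T -> R).

Definition continuous_on D f := forall x, D x -> {for x, continuous f}.

Lemma continuous_on_cst D (c : R) : continuous_on D (fun _ => c).
Proof. by move=> x _; exact: cst_continuous. Qed.

Lemma continuous_onD D f g : continuous_on D f -> continuous_on D g ->
  continuous_on D (fun x => f x + g x).
Proof. by move=> cf cg x Dx; apply: cvgD (cf x Dx) (cg x Dx). Qed.

Lemma continuous_onM D f g : continuous_on D f -> continuous_on D g ->
  continuous_on D (fun x => f x * g x).
Proof. by move=> cf cg x Dx; apply: cvgM (cf x Dx) (cg x Dx). Qed.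

Lemma continuous_onX D f k : continuous_on D f -> continuous_on D (fun x => f x ^+ k).
Proof.
move=> cf; elim: k => [|k IH].
  by rewrite (_ : (fun _ => _) = fun _ => 1); [exact: continuous_on_cst|exact/funext].
rewrite (_ : (fun _ => _) = fun x => f x * f x ^+ k); first exact: continuous_onM.
by apply/funext => x; rewrite exprS.
Qed.

Lemma continuous_on_sum D (I : Type) (r : seq I) (f : I -> T -> R) :
  (forall i, continuous_on D (f i)) -> continuous_on D (fun x => \sum_(i <- r) f i x).
Proof.
move=> cf x Dx; apply: (@cvg_sumr R _ (nbhs x) _ _ _ xpredT f) => i _.
exact: cf.
Qed.

End continuity_on.

(** * The singular cutoff and the error it produces *)

Section weighted_field.
Context {R : realType} {n : nat}.
Local Notation V := 'rV[R]_n.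
Local Notation mu := (@lebesgue_rV R n).
Variables (D : set V) (M : R).
Hypotheses (oD : open D) (DM : forall x, D x -> `|x| <= M).
Variables (rho : V -> R) (drho : 'I_n -> V -> R) (d2rho : 'I_n -> 'I_n -> V -> R).
Hypotheses (rhoC : C1 D rho drho) (drhoC : forall j, C1 D (drho j) (d2rho j))
  (rho_lt0 : forall x, D x -> rho x < 0)
  (rho_convex : forall x (v : V), D x ->
    0 <= \sum_j v 0 j * \sum_k v 0 k * d2rho k j x).
Variables (zeta : V -> R) (dzeta : 'I_n -> V -> R).
Hypotheses (zetaC : C1 D zeta dzeta)
  (zeta_rho : forall x, ~ D x -> (\forall y \near x, D y -> zeta y = 0) \/
    {for x, continuous rho} /\ 0 <= rho x).

Let w x := (rho x)^-1.

(* On D, where rho < 0, this vanishes exactly when rho x >= - eps. *)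
Definition cutoff (eps : R) x := pos (1 + eps * w x).

Let wC : C1 D w (fun i x => - w x ^+ 2 * drho i x).
Proof.
apply: (C1_comp (P := fun t => t^-1) (dP := fun t => - t^-1 ^+ 2) rhoC) => x Dx.
have r0 : rho x != 0 by rewrite lt_eqF// rho_lt0.
split.
  have := @is_deriveV R id (rho x) 1 1 r0 _.
  by rewrite exprVn [_ *: _]mulr1; apply.
apply: (@continuousN _ _ _ (fun t : R => t^-1 ^+ 2)).
have cV : {for rho x, continuous (fun t : R => t^-1)}.
  exact: inv_continuous.
exact: (@continuousM _ _ (fun t : R => t^-1) (fun t : R => t^-1)).
Qed.

Let cutC eps : C1 D (fun x => 1 + eps * w x) (fun i x => - eps * w x ^+ 2 * drho i x).
Proof.
have := C1D (@C1_cst R n D 1) (C1M (@C1_cst R n D eps) wC).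
by apply: C1_eq => // x Dx i; rewrite /cst; ring.
Qed.

Let pos_sqr (t : R) : t * pos t = pos t ^+ 2.
Proof. by rewrite /pos; case: leP => [|//]; rewrite ?mulr0 ?expr0n// expr2. Qed.

Let pC eps : C1 D (fun x => cutoff eps x ^+ 2)
  (fun i x => - 2 * cutoff eps x * eps * w x ^+ 2 * drho i x).
Proof.
have := C1_comp (P := fun t => pos t ^+ 2) (dP := fun t => 2 * pos t) (cutC eps).
move=> H; have {}H := H _; apply: C1_eq (H _) => // [x Dx i|x Dx].
  by rewrite /cutoff; ring.
split; first exact: is_derive_pos2.
apply: (@continuousM _ _ (cst 2) pos); first exact: cst_continuous.
exact: pos_continuous.
Qed.

Lemma cutoff_continuous eps x : D x -> {for x, continuous (cutoff eps)}.
Proof.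
move=> Dx; have [cq _] := cutC eps Dx.
exact: (continuous_comp cq (@pos_continuous R _)).
Qed.

Definition cut_s eps x := zeta x * cutoff eps x ^+ 2.
Definition cut_ds eps i x := dzeta i x * cutoff eps x ^+ 2 -
  2 * zeta x * cutoff eps x * eps * w x ^+ 2 * drho i x.

(* The weight m such that 2 s d_i s = 2 zeta d_i zeta q^4 - m d_i rho, where
   q = cutoff eps and s = cut_s eps. *)
Definition cut_m eps x := 4 * zeta x ^+ 2 * cutoff eps x ^+ 3 * eps * w x ^+ 2.
Definition cut_dm eps i x := 8 * zeta x * dzeta i x * cutoff eps x ^+ 3 * eps * w x ^+ 2
  - 12 * zeta x ^+ 2 * cutoff eps x ^+ 2 * (eps * w x ^+ 2) ^+ 2 * drho i x
  - 8 * zeta x ^+ 2 * cutoff eps x ^+ 3 * eps * w x ^+ 3 * drho i x.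

Lemma cut_s_C1 eps : C1 D (cut_s eps) (cut_ds eps).
Proof.
have := C1M zetaC (pC eps); apply: C1_eq => // x Dx i.
by rewrite /cut_ds; ring.
Qed.

Let p3C eps : C1 D (fun x => cutoff eps x ^+ 3)
  (fun i x => - 3 * cutoff eps x ^+ 2 * eps * w x ^+ 2 * drho i x).
Proof.
(* The cube is written as [(1 + eps * w) * cutoff ^+ 2], which holds since [t * pos t = pos t ^+ 2];
   only the derivative of the square is then needed. *)
have := C1M (cutC eps) (pC eps); apply: C1_eq => // x Dx => [|i].
  by rewrite expr2 mulrA pos_sqr -exprSr.
have := pos_sqr (1 + eps * w x); rewrite -/(cutoff eps x).
set q := 1 + eps * w x; set p := cutoff eps x => qp.
transitivity (- eps * w x ^+ 2 * drho i x * p ^+ 2 -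
  2 * eps * w x ^+ 2 * drho i x * (q * p)); [ring|rewrite qp; ring].
Qed.

Lemma cut_m_C1 eps : C1 D (cut_m eps) (cut_dm eps).
Proof.
have := C1M (C1M (C1M (@C1_cst R n D (4 * eps)) (C1M zetaC zetaC)) (p3C eps))
  (C1M wC wC).
apply: C1_eq => // x Dx => [|i]; rewrite /cut_m /cut_dm /cst; ring.
Qed.

(** Neither factor has compact support in [D] by itself: [zeta] takes care of the spherical part of
    the boundary of [D], [cutoff] of the part lying on the boundary of the domain. *)
Lemma cutoff_vanishes eps x : 0 < eps -> ~ D x ->
  (\forall y \near x, D y -> zeta y = 0) \/
  (\forall y \near x, D y -> cutoff eps y = 0).
Proof.
move=> e0 /zeta_rho[|[crho rx]]; first by left.
right; have rN : \forall y \near x, - eps < rho y.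
  by apply: (crho _ (lt_nbhsr _)); rewrite (lt_le_trans _ rx)// oppr_lt0.
near=> y => Dy; have r0 := rho_lt0 Dy; have re : - eps < rho y by near: y.
rewrite /cutoff /pos max_r// /w addrC -lerBrDr sub0r.
by rewrite ler_ndivrMr// mulN1r lerNl ltW.
Unshelve. all: by end_near. Qed.

Lemma cut_s_vanishes eps : 0 < eps -> vanishes_off D (cut_s eps).
Proof.
move=> e0 x /(cutoff_vanishes e0)[]; apply: filterS => y + Dy => /(_ Dy) E.
  by rewrite /cut_s E mul0r.
by rewrite /cut_s E expr0n mulr0.
Qed.

Lemma cut_m_vanishes eps : 0 < eps -> vanishes_off D (cut_m eps).
Proof.
move=> e0 x /(cutoff_vanishes e0)[]; apply: filterS => y + Dy => /(_ Dy) E.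
  by rewrite /cut_m E expr0n/= mulr0 !mul0r.
by rewrite /cut_m E expr0n/= mulr0 !mul0r.
Qed.

Variables (F : 'I_n -> V -> R) (dF : 'I_n -> 'I_n -> V -> R).
Hypotheses (FC : forall j, C1 D (F j) (fun i => dF i j))
  (divF : forall x, D x -> \sum_j dF j j x = 0).

Definition normal_part x := \sum_i F i x * drho i x.

Let normal_partC : C1 D normal_part
  (fun j x => \sum_i (dF j i x * drho i x + F i x * d2rho i j x)).
Proof. by apply: C1_sum => i; exact: C1M. Qed.

(** The term [(F . grad rho) (F . grad m)] of the transport identity, in which all derivatives fall
    on the weight. *)
Definition cut_error eps x := normal_part x * (\sum_j F j x * cut_dm eps j x).

(** The quadratic form for [s = zeta q^2] contains [- m] times the sum of [d_i rho F_j d_j F_i].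
    Adding the transport identity for the weight [m] and [g = F . grad rho] cancels it, at the price
    of [m] times the Hessian of [rho] at [(F, F)] and of [cut_error]. *)
Definition cut_form eps x := quad_form F dF (cut_s eps) (cut_ds eps) x +
  (cut_m eps x * (\sum_j F j x * (\sum_i (dF j i x * drho i x + F i x * d2rho i j x)))
   + cut_error eps x).

Lemma cut_form_integral eps : 0 < eps ->
  mu.-integrable D (EFin \o cut_form eps) /\ \int[mu]_(x in D) cut_form eps x = 0.
Proof.
move=> e0; have mD : measurable D by exact: open_measurable_rV.
have [i1 I1] := quad_form_integral oD DM FC divF (cut_s_C1 eps) (cut_s_vanishes e0).
have [i2 I2] := transport_integral oD DM FC divF (cut_m_C1 eps)
  (cut_m_vanishes e0) normal_partC.
split; last by rewrite RintegralD// I1 I2 addr0.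
by apply: (eq_integrable mD) (integrableD mD i1 i2).
Qed.

(* The two singular terms combine into the second fundamental form of the
   level sets of rho, which is nonnegative by convexity. *)
Lemma cut_form_ge eps (c : R) x : 0 < eps -> 0 < c -> D x ->
  cutoff eps x ^+ 4 * (zeta x ^+ 2 * (\sum_i \sum_j dF i j x * dF j i x)
    - c * zeta x ^+ 2 * (\sum_i \sum_j dF j i x ^+ 2)
    - c^-1 * (\sum_i \sum_j (dzeta i x * F j x) ^+ 2)) + cut_error eps x
  <= cut_form eps x.
Proof.
move=> e0 c0 Dx; rewrite /cut_form /quad_form addrA lerD2r.
set p := cutoff eps x; set z := zeta x.
set T := \sum_i \sum_j dF i j x * dF j i x.
have p0 : 0 <= p by rewrite /p /cutoff /pos le_max lexx orbT.
have m0 : 0 <= cut_m eps x.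
  rewrite /cut_m; apply: mulr_ge0; last exact: sqr_ge0.
  apply: mulr_ge0; last exact: ltW.
  apply: mulr_ge0; last exact: exprn_ge0.
  by apply: mulr_ge0 => //; exact: sqr_ge0.
have E1 : \sum_i \sum_j 2 * cut_s eps x * cut_ds eps i x * F j x * dF j i x =
    p ^+ 4 * (\sum_i \sum_j 2 * z * (dzeta i x * F j x) * dF j i x) -
    cut_m eps x * (\sum_i \sum_j drho i x * F j x * dF j i x).
  rewrite !mulr_sumr -sumrB; apply: eq_bigr => i _.
  rewrite !mulr_sumr -sumrB; apply: eq_bigr => j _.
  rewrite /cut_s /cut_ds /cut_m -/p -/z; ring.
have E2 : \sum_j F j x * (\sum_i (dF j i x * drho i x + F i x * d2rho i j x)) =
    \sum_i \sum_j drho i x * F j x * dF j i x +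
    \sum_j F j x * (\sum_i F i x * d2rho i j x).
  rewrite exchange_big -big_split/=; apply: eq_bigr => j _.
  rewrite big_split/= mulrDr; congr (_ + _); rewrite mulr_sumr.
  by apply: eq_bigr => i _; ring.
have C0 : 0 <= \sum_j F j x * (\sum_i F i x * d2rho i j x).
  have := rho_convex (\row_j F j x) Dx; under eq_bigr => j _.
    rewrite mxE; under eq_bigr do rewrite mxE.
    over.
  exact.
rewrite E1 E2; set S1 := \sum_i \sum_j drho i x * _ * _.
set C := \sum_j F j x * _ in C0 *.
set Y := \sum_i \sum_j _ * _ * _.
(* Young's inequality with parameter [c] for the terms containing the gradient of [zeta]; the gap is
   the square [c * (z * b + c^-1 * a) ^+ 2]. *)
have Y0 : - (c * z ^+ 2 * (\sum_i \sum_j dF j i x ^+ 2))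
    - c^-1 * (\sum_i \sum_j (dzeta i x * F j x) ^+ 2) <= Y.
  rewrite -subr_ge0 opprD !opprK /Y !mulr_sumr -!big_split/=.
  apply: sumr_ge0 => i _; rewrite !mulr_sumr -!big_split/=.
  apply: sumr_ge0 => j _; set a := dzeta i x * F j x; set b := dF j i x.
  have -> : 2 * z * a * b + (c * z ^+ 2 * b ^+ 2 + c^-1 * a ^+ 2) =
      c * (z * b + c^-1 * a) ^+ 2 by field; rewrite gt_eqF.
  by rewrite mulr_ge0 ?sqr_ge0// ltW.
have mC : 0 <= cut_m eps x * C by rewrite mulr_ge0.
have p4 : 0 <= p ^+ 4 by exact: exprn_ge0.
rewrite (_ : cut_s eps x ^+ 2 = z ^+ 2 * p ^+ 4); last first.
  by rewrite /cut_s -/p -/z; ring.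
nra.
Qed.

End weighted_field.

(** * Passage to the limit in the cutoff *)

Section weighted_estimate.
Context {R : realType} {n : nat}.
Local Notation V := 'rV[R]_n.
Local Notation mu := (@lebesgue_rV R n).
Variables (D : set V) (M : R).
Hypotheses (oD : open D) (DM : forall x, D x -> `|x| <= M).
Variables (rho : V -> R) (drho : 'I_n -> V -> R) (d2rho : 'I_n -> 'I_n -> V -> R).
Hypotheses (rhoC : C1 D rho drho) (drhoC : forall j, C1 D (drho j) (d2rho j))
  (rho_lt0 : forall x, D x -> rho x < 0)
  (rho_convex : forall x (v : V), D x ->
    0 <= \sum_j v 0 j * \sum_k v 0 k * d2rho k j x).
Variables (zeta : V -> R) (dzeta : 'I_n -> V -> R).
Hypotheses (zetaC : C1 D zeta dzeta)
  (zeta_rho : forall x, ~ D x -> (\forall y \near x, D y -> zeta y = 0) \/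
    {for x, continuous rho} /\ 0 <= rho x).
Variables (F : 'I_n -> 'I_n -> V -> R) (dF : 'I_n -> 'I_n -> 'I_n -> V -> R).
Hypotheses (FC : forall k j, C1 D (F k j) (fun i => dF k i j))
  (divF : forall k x, D x -> \sum_j dF k j j x = 0).

Let w x := (rho x)^-1.
Let T x := \sum_k \sum_i \sum_j dF k i j x * dF k j i x.
Let S x := \sum_k \sum_i \sum_j dF k j i x ^+ 2.
Let Z x := \sum_k \sum_i \sum_j (dzeta i x * F k j x) ^+ 2.
Let A k x := \sum_j F k j x * dzeta j x.
Let G k x := zeta x * w x * normal_part drho (F k) x.

Variables (c K : R).
Hypotheses (c0 : 0 < c) (cST : forall x, D x -> c * S x <= T x / 2).
Hypotheses (TK : forall x, D x -> zeta x ^+ 2 * T x <= K)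
  (ZK : forall x, D x -> Z x <= K)
  (GK : forall k x, D x -> `|G k x| <= K)
  (AK : forall k x, D x -> `|A k x| <= K).

(** [p] stands for the cutoff and [t] for [eps / rho]. Every monomial contains [t], so the error
    tends to 0 pointwise; every monomial has at least as many factors [p] as [t], so it is bounded
    uniformly in [eps], because [p * |t| <= 1]. *)
Let err_poly k x (p t : R) := 8 * p ^+ 3 * t * G k x * A k x
  - 12 * p ^+ 2 * t ^+ 2 * G k x ^+ 2 - 8 * p ^+ 3 * t * G k x ^+ 2.

Let cut_errorE eps k x :
  cut_error rho drho zeta dzeta (F k) eps x =
  err_poly k x (cutoff rho eps x) (eps * w x).
Proof.
rewrite /cut_error; set g := normal_part _ _ _; set p := cutoff rho eps x.
have -> : \sum_j F k j x * cut_dm rho drho zeta dzeta eps j x =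
  8 * zeta x * p ^+ 3 * eps * w x ^+ 2 * A k x
  - (12 * zeta x ^+ 2 * p ^+ 2 * (eps * w x ^+ 2) ^+ 2
    + 8 * zeta x ^+ 2 * p ^+ 3 * eps * w x ^+ 3) * g.
  rewrite /A /g /normal_part !mulr_sumr -sumrB; apply: eq_bigr => j _.
  by rewrite /cut_dm -/p -/(w x); ring.
by rewrite /err_poly /G -/g; ring.
Qed.

(** The part of the lower bound for the forms on which the limit is taken: half of [T] has absorbed
    [c * S], the Hessian term has been dropped for its sign, and what is left is bounded uniformly
    in [eps]. *)
Let f eps x := cutoff rho eps x ^+ 4 * (zeta x ^+ 2 * T x / 2) +
  \sum_k cut_error rho drho zeta dzeta (F k) eps x.

Let form eps k x := cut_form rho drho d2rho zeta dzeta (F k) (dF k) eps x.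

Let cutoff_bounds eps x : 0 < eps -> D x ->
  [/\ 0 <= cutoff rho eps x, cutoff rho eps x <= 1 &
  cutoff rho eps x * `|eps * w x| <= 1].
Proof.
move=> e0 Dx; have w0 : eps * w x < 0.
  by rewrite pmulr_rlt0// invr_lt0 rho_lt0.
rewrite /cutoff -/(w x) ltr0_norm//; set t := eps * w x in w0 *.
rewrite /pos; have [h|h] := leP (1 + t) 0; first by rewrite mul0r ler01 lexx.
by split; [exact: ltW|lra|nra].
Qed.

Let S0 x : 0 <= S x.
Proof. by do 3!(apply: sumr_ge0 => ? _); exact: sqr_ge0. Qed.

Let Z0 x : 0 <= Z x.
Proof. by do 3!(apply: sumr_ge0 => ? _); exact: sqr_ge0. Qed.

Let T0 x : D x -> 0 <= T x.
Proof.
move=> Dx; have := cST Dx; have : 0 <= c * S x by rewrite mulr_ge0// ltW.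
lra.
Qed.

Let f_le eps x : 0 < eps -> D x -> f eps x <= c^-1 * Z x + \sum_k form eps k x.
Proof.
move=> e0 Dx; have [p0 p1 _] := cutoff_bounds e0 Dx.
have H : \sum_k (cutoff rho eps x ^+ 4 *
    (zeta x ^+ 2 * (\sum_i \sum_j dF k i j x * dF k j i x)
    - c * zeta x ^+ 2 * (\sum_i \sum_j dF k j i x ^+ 2)
    - c^-1 * (\sum_i \sum_j (dzeta i x * F k j x) ^+ 2))
    + cut_error rho drho zeta dzeta (F k) eps x) <= \sum_k form eps k x.
  by apply: ler_sum => k _; apply: cut_form_ge Dx => //.
rewrite big_split/= -mulr_sumr !sumrB -!mulr_sumr -/(T x) -/(S x) -/(Z x) in H.
rewrite /f; set p := cutoff rho eps x in p0 p1 H *.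
have p4 : 0 <= p ^+ 4 <= 1 by rewrite exprn_ge0// exprn_ile1.
have ciZ : 0 <= c^-1 * Z x by rewrite mulr_ge0// invr_ge0 ltW.
have : p ^+ 4 * (zeta x ^+ 2 * T x / 2) <=
   p ^+ 4 * (zeta x ^+ 2 * T x - c * zeta x ^+ 2 * S x).
  apply: ler_wpM2l; first by case/andP: p4.
  have := cST Dx; have := sqr_ge0 (zeta x); nra.
move: p4 => /andP[p40 p41]; nra.
Qed.

(** 28 = 8 + 12 + 8 adds up the coefficients of [err_poly]. *)
Let f_bound eps x : 0 < eps -> D x -> `|f eps x| <= K + \sum_(k < n) 28 * K ^+ 2.
Proof.
move=> e0 Dx; have [p0 p1 pt] := cutoff_bounds e0 Dx.
rewrite /f; apply: le_trans (ler_normD _ _) _; apply: lerD.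
  have t0 : 0 <= zeta x ^+ 2 * T x by rewrite mulr_ge0 ?sqr_ge0 ?T0.
  have tK := TK Dx.
  rewrite ger0_norm; last by rewrite mulr_ge0 ?exprn_ge0// divr_ge0.
  have : cutoff rho eps x ^+ 4 <= 1 by rewrite exprn_ile1.
  have : 0 <= cutoff rho eps x ^+ 4 by rewrite exprn_ge0.
  nra.
apply: le_trans (ler_norm_sum _ _ _) _; apply: ler_sum => k _.
rewrite cut_errorE /err_poly; set p := cutoff rho eps x in p0 p1 pt *.
set t := eps * w x in pt *; have := GK k Dx; have := AK k Dx.
set g := G k x; set a := A k x => aK gK.
have K0 : 0 <= K by apply: le_trans aK.
have pt' : `|p * t| <= 1 by rewrite normrM (ger0_norm p0).
have ga : `|g * a| <= K ^+ 2 by rewrite normrM expr2 ler_pM.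
have gg : `|g * g| <= K ^+ 2 by rewrite normrM expr2 ler_pM.
have p2 : `|p ^+ 2| <= 1 by rewrite ger0_norm ?exprn_ge0// exprn_ile1.
have bound (a1 a2 : R) : `|a1| <= 1 -> `|a2| <= K ^+ 2 -> `|a1 * a2| <= K ^+ 2.
  by move=> h1 h2; rewrite normrM -[leRHS]mul1r ler_pM.
have b1 : `|(p ^+ 2 * (p * t)) * (g * a)| <= K ^+ 2.
  by apply: bound => //; rewrite normrM -[leRHS]mul1r ler_pM.
have b2 : `|((p * t) * (p * t)) * (g * g)| <= K ^+ 2.
  by apply: bound => //; rewrite normrM -[leRHS]mul1r ler_pM.
have b3 : `|(p ^+ 2 * (p * t)) * (g * g)| <= K ^+ 2.
  by apply: bound => //; rewrite normrM -[leRHS]mul1r ler_pM.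
have -> : 8 * p ^+ 3 * t * g * a - 12 * p ^+ 2 * t ^+ 2 * g ^+ 2 -
    8 * p ^+ 3 * t * g ^+ 2 = 8 * ((p ^+ 2 * (p * t)) * (g * a)) -
    12 * (((p * t) * (p * t)) * (g * g)) - 8 * ((p ^+ 2 * (p * t)) * (g * g)).
  by ring.
move: b1 b2 b3; rewrite !ler_norml => /andP[? ?] /andP[? ?] /andP[? ?].
by apply/andP; split; lra.
Qed.

Let cF k j : continuous_on D (F k j). Proof. by move=> x /(FC k j)[]. Qed.
Let cdF k i j : continuous_on D (dF k i j).
Proof. by move=> x /(FC k j)[_ /(_ i)[]]. Qed.
Let czeta : continuous_on D zeta. Proof. by move=> x /zetaC[]. Qed.
Let cdzeta i : continuous_on D (dzeta i).
Proof. by move=> x /zetaC[_ /(_ i)[]]. Qed.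

Let cT : continuous_on D T.
Proof.
do 3!apply: continuous_on_sum => ?; exact: continuous_onM.
Qed.

Let cZ : continuous_on D Z.
Proof.
do 3!apply: continuous_on_sum => ?; apply: continuous_onX; exact: continuous_onM.
Qed.

Let cf eps : continuous_on D (f eps).
Proof.
apply: continuous_onD.
  apply: continuous_onM.
    by apply: continuous_onX => x Dx; exact: cutoff_continuous rhoC rho_lt0 _ _ Dx.
  apply: continuous_onM; last exact: continuous_on_cst.
  by apply: continuous_onM => //; exact: continuous_onX.
apply: continuous_on_sum => k; apply: continuous_onM; apply: continuous_on_sum => j.
  by apply: continuous_onM => // x /rhoC[_ /(_ j)[]].
apply: continuous_onM => // x Dx.
by have [_ /(_ j)[]] := cut_m_C1 oD rhoC rho_lt0 zetaC eps Dx.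
Qed.

Let f_cvg x : D x -> f m.+1%:R^-1 x @[m --> \oo] --> zeta x ^+ 2 * T x / 2.
Proof.
move=> Dx.
pose h t := pos (1 + t) ^+ 4 * (zeta x ^+ 2 * T x / 2) +
  \sum_k err_poly k x (pos (1 + t)) t.
have -> : (fun m => f m.+1%:R^-1 x) = fun m => h (m.+1%:R^-1 * w x).
  by apply/funext => m; rewrite /f /h; congr (_ + _); apply: eq_bigr => k _;
    rewrite cut_errorE.
have -> : zeta x ^+ 2 * T x / 2 = h 0.
  rewrite /h addr0 /pos max_l// expr1n mul1r big1 ?addr0// => k _.
  by rewrite /err_poly; ring.
have cid : continuous_on setT (fun t : R => t) by move=> t _ ?.
have c1 : continuous_on setT (fun t : R => pos (1 + t)).
  move=> t _; apply: (@continuous_comp _ _ _ (fun t : R => 1 + t) pos).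
    exact: (continuous_onD (@continuous_on_cst _ _ setT 1) cid I).
  exact: pos_continuous.
have ch : continuous_on setT h.
  apply: continuous_onD.
    apply: continuous_onM; [exact: continuous_onX|exact: continuous_on_cst].
  apply: continuous_on_sum => k.
  have cc (a : R) j l b : continuous_on setT
      (fun t : R => a * pos (1 + t) ^+ j * t ^+ l * b).
    apply: continuous_onM; last exact: continuous_on_cst.
    apply: continuous_onM; last exact: continuous_onX.
    by apply: continuous_onM; [exact: continuous_on_cst|exact: continuous_onX].
  rewrite (_ : (fun t => _) = fun t => 8 * pos (1 + t) ^+ 3 * t ^+ 1 * (G k x * A k x)
    + (-12) * pos (1 + t) ^+ 2 * t ^+ 2 * G k x ^+ 2
    + (-8) * pos (1 + t) ^+ 3 * t ^+ 1 * G k x ^+ 2).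
    by do 2!(apply: continuous_onD => //).
  by apply/funext => t; rewrite /err_poly; ring.
have tc : m.+1%:R^-1 * w x @[m --> \oo] --> 0.
  rewrite -(mul0r (w x)); apply: cvgM; [exact: cvg_harmonic|exact: cvg_cst].
exact: (cvg_comp _ _ tc (ch 0 I)).
Qed.

(** For each [eps] the forms integrate to 0, so [f] integrates to at most [c^-1] times the integral
    of [Z], and [f] tends to [zeta ^+ 2 * T / 2]. The bound [K], which depends on the chart and on
    the solution, serves for domination and integrability only and is absent from the result. *)
Lemma weighted_estimate :
  \int[mu]_(x in D) (zeta x ^+ 2 * T x) <= 2 * c^-1 * \int[mu]_(x in D) Z x.
Proof.
have mD : measurable D by exact: open_measurable_rV.
have muD : (mu D < +oo)%E by exact: bounded_fin_measure DM.
pose e (m : nat) : R := m.+1%:R^-1.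
have e0 m : 0 < e m by rewrite invr_gt0.
have cvg_f : \int[mu]_(x in D) f (e m) x @[m --> \oo] -->
    \int[mu]_(x in D) (zeta x ^+ 2 * T x / 2).
  apply: (@bounded_dominated_convergence _ _ _ mu D (fun m => f (e m)) _
    (K + \sum_(k < n) 28 * K ^+ 2)) => //.
  - by move=> m; apply: continuous_measurable_rV => //; exact: cf.
  - apply: continuous_measurable_rV => //.
    apply: continuous_onM; last exact: continuous_on_cst.
    by apply: continuous_onM => //; exact: continuous_onX.
  - by move=> m x; exact: f_bound.
have iZ : mu.-integrable D (EFin \o (fun x => c^-1 * Z x)).
  apply: (@integrable_bounded_open _ _ D M oD DM _ (c^-1 * K)).
    by apply: continuous_onM => //; exact: continuous_on_cst.
  move=> x Dx; rewrite ger0_norm; last by rewrite mulr_ge0// invr_ge0 ltW.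
  by rewrite ler_pM2l ?invr_gt0// ZK.
have iform m k := (cut_form_integral oD DM rhoC drhoC rho_lt0 zetaC zeta_rho
  (FC k) (@divF k) (e0 m)).
have iF m : mu.-integrable D (EFin \o f (e m)).
  by apply: (@integrable_bounded_open _ _ D M oD DM _ _ (@cf (e m))) => x; exact: f_bound.
have If m : \int[mu]_(x in D) f (e m) x <= c^-1 * \int[mu]_(x in D) Z x.
  have iS : mu.-integrable D (EFin \o (fun x => \sum_k form (e m) k x)).
    by apply: integrable_sumr => // k; have [] := iform m k.
  have iA := integrableD mD iZ iS.
  apply: (@le_trans _ _ (\int[mu]_(x in D) (c^-1 * Z x + \sum_k form (e m) k x))).
    by apply: le_Rintegral => // x; exact: f_le.
  rewrite RintegralD// Rintegral_sumr//; last by move=> k; have [] := iform m k.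
  rewrite big1 ?addr0 => [|k _]; last by have [] := iform m k.
  rewrite RintegralZl//.
  apply: (@integrable_bounded_open _ _ D M oD DM _ K) => [//|x Dx].
  by rewrite ger0_norm ?ZK.
have : \int[mu]_(x in D) (zeta x ^+ 2 * T x / 2) <= c^-1 * \int[mu]_(x in D) Z x.
  apply: (closed_cvg (fun y => y <= c^-1 * \int[mu]_(x in D) Z x)) cvg_f.
    exact: closed_le.
  exact: nearW.
rewrite RintegralZr//; first by lra.
apply: (@integrable_bounded_open _ _ D M oD DM _ K) => [|x Dx].
  by apply: continuous_onM => //; exact: continuous_onX.
by rewrite ger0_norm ?TK// mulr_ge0 ?sqr_ge0 ?T0.
Qed.

End weighted_estimate.

(** * The radial cutoff *)

Section radial_cutoff.
Context {R : realType} {n : nat}.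
Local Notation V := 'rV[R]_n.
Variables (x0 : V) (a : R).

(** [a] is the square of the radius of the ball off which the cutoff vanishes. It is not normalised:
    its value at the centre is [a ^+ 2], and the scaling is settled at the end of the proof. *)
Definition radial_cutoff (x : V) := pos (a - enorm (x - x0) ^+ 2) ^+ 2.
Definition radial_cutoff' (i : 'I_n) (x : V) :=
  - 4 * pos (a - enorm (x - x0) ^+ 2) * (x 0 i - x0 0 i).

Lemma sqr_enorm_C1 : C1 setT (fun x : V => enorm (x - x0) ^+ 2)
  (fun i x => 2 * (x 0 i - x0 0 i)).
Proof.
have C i := C1D (@C1_coord R n i) (@C1_cst R n setT (- x0 0 i)).
have := C1_sum (fun i => C1M (C i) (C i)); apply: C1_eq => [|x _|x _ i].
- exact: openT.
- by rewrite sqr_enorm; apply: eq_bigr => i _; rewrite !mxE expr2.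
- rewrite (bigD1 i)//= big1 => [|j ji]; rewrite /cst.
    by rewrite eqxx/=; ring.
  by rewrite eq_sym (negbTE ji)/=; ring.
Qed.

Lemma radial_cutoff_C1 : C1 setT radial_cutoff radial_cutoff'.
Proof.
have H := C1D (@C1_cst R n setT a) (C1M (@C1_cst R n setT (- 1)) sqr_enorm_C1).
have := C1_comp (P := fun t => pos t ^+ 2) (dP := fun t => 2 * pos t) H.
move=> {}H; have {}H := H _; apply: C1_eq (H _) => // [|x _|x _ i|x _].
- exact: openT.
- by rewrite /radial_cutoff /cst mulN1r.
- by rewrite /radial_cutoff' /cst mulN1r; ring.
- split; first exact: is_derive_pos2.
  apply: (@continuousM _ _ (cst 2) pos); first exact: cst_continuous.
  exact: pos_continuous.
Qed.

Lemma radial_cutoff_ge0 x : 0 <= radial_cutoff x.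
Proof. exact: sqr_ge0. Qed.

Lemma pos_radial_le x : 0 <= a -> pos (a - enorm (x - x0) ^+ 2) <= a.
Proof.
by move=> a0; rewrite /pos ge_max a0 andbT lerBlDr lerDl sqr_ge0.
Qed.

Lemma pos_ge0 (t : R) : 0 <= pos t.
Proof. by rewrite /pos le_max lexx orbT. Qed.

Lemma radial_cutoff_le x : 0 <= a -> radial_cutoff x <= a ^+ 2.
Proof.
by move=> a0; rewrite /radial_cutoff lerXn2r ?nnegrE ?pos_ge0// pos_radial_le.
Qed.

(** The squared gradient is [16 * p ^+ 2 * enorm (x - x0) ^+ 2], where [p <= a], and the last factor
    is at most [a] wherever [p] is not 0. *)
Lemma radial_cutoff'_sqr x : 0 <= a ->
  \sum_i radial_cutoff' i x ^+ 2 <= 16 * a ^+ 3.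
Proof.
move=> a0; set p := pos (a - enorm (x - x0) ^+ 2).
have -> : \sum_i radial_cutoff' i x ^+ 2 = 16 * p ^+ 2 * enorm (x - x0) ^+ 2.
  rewrite sqr_enorm mulr_sumr; apply: eq_bigr => i _.
  by rewrite /radial_cutoff' -/p !mxE; ring.
have := pos_radial_le x a0; rewrite -/p => pa.
have p0 : 0 <= p by exact: pos_ge0.
have N0 := sqr_ge0 (enorm (x - x0)).
have [h|h] := leP (a - enorm (x - x0) ^+ 2) 0.
  by rewrite /p /pos max_r// expr0n mulr0 mul0r mulr_ge0// exprn_ge0.
have Na : enorm (x - x0) ^+ 2 <= a by rewrite ltW// -subr_gt0.
rewrite [a ^+ 3]exprSr mulrA; apply: ler_pM => //; first by rewrite mulr_ge0 ?sqr_ge0.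
by rewrite ler_pM2l// lerXn2r ?nnegrE.
Qed.

Lemma radial_cutoff_gt0 x : radial_cutoff x != 0 -> enorm (x - x0) ^+ 2 < a.
Proof.
apply: contraNT; rewrite -leNgt => h.
by rewrite /radial_cutoff /pos max_r ?expr0n// subr_le0.
Qed.

Lemma radial_cutoff_vanishes x : a < enorm (x - x0) ^+ 2 ->
  \forall y \near x, radial_cutoff y = 0.
Proof.
move=> ax; have [c _] := sqr_enorm_C1 I (x := x).
have : \forall y \near x, a < enorm (y - x0) ^+ 2 by exact: (c _ (lt_nbhsr ax)).
apply: filterS => y ay.
by rewrite /radial_cutoff /pos max_r ?expr0n// subr_le0 ltW.
Qed.

End radial_cutoff.

Section coordinates.
Context {R : realType} {V : normedModType R} {m : nat}.

Lemma is_derive_coord (f : V -> 'rV[R]_m) x v df k :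
  is_derive x v f df -> is_derive x v (fun y => f y 0 k) (df 0 k).
Proof.
move=> [fx <-]; have fk := (derivable_mxP f x v).1 fx 0 k.
by apply: DeriveDef => //; rewrite derive_mx// mxE.
Qed.

End coordinates.

(** * Linear decay of functions vanishing on the boundary *)

Section boundary_decay.
Context {R : realType} {n : nat}.
Local Notation V := 'rV[R]_n.

Lemma axis_norm (i : 'I_n) (b : bool) (x : V) (t : R) :
  enorm (x + t *: graph_axis i b) ^+ 2 <= (enorm x + `|t|) ^+ 2.
Proof.
have -> : enorm (x + t *: graph_axis i b) ^+ 2 =
    enorm x ^+ 2 + 2 * t * (-1) ^+ b * x 0 i + t ^+ 2.
  rewrite !sqr_enorm (bigD1 i)//= [X in _ = X + _ + _](bigD1 i)//= !mxE !eqxx mulr1.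
  rewrite (eq_bigr (fun j => x 0 j ^+ 2)) => [|j ji]; last first.
    by rewrite !mxE (negbTE ji) andbF !mulr0 addr0.
  have := @signr_sqr R b; set e := (-1) ^+ b; set S := \sum_(_ | _) _ => e2.
  transitivity (x 0 i ^+ 2 + 2 * t * e * x 0 i + t ^+ 2 * (e * e) + S); first ring.
  by rewrite e2; ring.
have := coord_le_enorm x i; have := enorm_ge0 x => x0 xi.
have : t * (-1) ^+ b * x 0 i <= `|t| * enorm x.
  apply: le_trans (ler_norm _) _; rewrite !normrM normr_sign mulr1.
  by rewrite ler_wpM2l.
have := real_normK (num_real t); nra.
Qed.

(* Along the graph axis rho changes at unit speed, so the boundary is reached
   from x after a length - rho x. *)
Lemma boundary_decay (Omega : set V) x0 (r : R) i b rho drho d2rho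
    (g : V -> R) (dg : 'I_n -> V -> R) (L B : R) :
  open Omega -> 0 < r ->
  convex_chart Omega x0 (2 * r) i b rho drho d2rho ->
  let D := Dset Omega x0 (2 * r) in
  C1 D g dg -> {within closure D, continuous g} ->
  (forall x, D x -> `|g x| <= B) -> (forall x, D x -> `|dg i x| <= L) ->
  (forall y, Iset Omega x0 (2 * r) y -> g y = 0) ->
  forall x, D x -> enorm (x - x0) ^+ 2 < 9 / 4 * r ^+ 2 ->
  `|g x| <= Num.max L (2 * B / r) * - rho x.
Proof.
move=> oO r0 ch D gC gcl gB gL g0 x Dx xr.
have [r_x Ox] := Dx; set e := graph_axis i b : V.
pose tau := - rho x.
have tau0 : 0 < tau by rewrite oppr_gt0; exact/(chart_in ch r_x).
(* If [tau >= r / 2], the plain bound [B] is already at most [2 * B / r * tau]. Otherwise the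
   boundary point reached from [x] stays inside the ball, as [3 / 2 * r + r / 2 = 2 * r]. *)
rewrite -/tau; have [tr|rt] := ltP tau (r / 2); last first.
  apply: (@le_trans _ _ (2 * B / r * tau)); last by rewrite ler_pM2r// le_max lexx orbT.
  apply: le_trans (gB x Dx) _.
  have B0 : 0 <= B by apply: le_trans (gB x Dx).
  by rewrite mulrAC ler_pdivlMr//; nra.
have L0 : 0 <= L by apply: le_trans (gL x Dx).
pose xs s := x + (- s) *: e.
have rho_xs s : rho (xs s) = s - tau by rewrite (chart_axis ch) /tau opprK opprK addrC.
have xs_ball s : 0 <= s -> s <= tau -> eball x0 (2 * r) (xs s).
  move=> s0 st; rewrite /eball/= -(@ltr_pXn2r _ 2) ?nnegrE ?enorm_ge0//; last first.
    by rewrite mulr_ge0// ltW.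
  rewrite (_ : xs s - x0 = (x - x0) + (- s) *: e); last by rewrite /xs addrAC.
  apply: le_lt_trans (axis_norm _ _ _ _) _; rewrite normrN ger0_norm//.
  have N0 := enorm_ge0 (x - x0); set N := enorm _ in xr N0 *.
  have N_r : N < 3 / 2 * r by rewrite -(@ltr_pXn2r _ 2) ?nnegrE//; lra.
  rewrite ltr_pXn2r ?nnegrE//; lra.
have xs_D s : 0 <= s -> s < tau -> D (xs s).
  move=> s0 st; have xsb := xs_ball s s0 (ltW st); split => //.
  by apply/(chart_in ch xsb); rewrite rho_xs subr_lt0.
pose y := xs tau; have yb : eball x0 (2 * r) y by apply: xs_ball => //; exact: ltW.
have approach (A : V -> Prop) : (\forall z \near y, A z) ->
    exists s, [/\ 0 < s, s < tau & A (xs s)].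
  move=> /(near_line e)[t0 t00 tA]; pose t := Num.min t0 (tau / 2).
  have t_gt0 : 0 < t by rewrite lt_min t00 divr_gt0.
  have [tt0 tt] : t <= t0 /\ t <= tau / 2 by rewrite /t !ge_min !lexx orbT.
  exists (tau - t); split; [lra|lra|].
  have := tA t; rewrite gtr0_norm// => /(_ tt0).
  rewrite /y /xs -addrA -scalerDl.
  by rewrite (_ : - tau + t = - (tau - t)) //; ring.
have cly : closure D y.
  move=> A /approach[s [s0 st As]]; exists (xs s); split => //.
  by apply: xs_D => //; exact: ltW.
have By : boundary Omega y.
  split; first by apply: closure_subset cly; exact: subIsetr.
  move=> /nbhs_singleton/(chart_in ch yb); rewrite /y rho_xs subrr ltxx.
  by [].
have gy : g y = 0 by exact: g0.
suff : `|g x| <= L * tau.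
  by move=> /le_trans; apply; rewrite ler_pM2r// le_max lexx.
(* [g] is differentiable inside [D] while [y] lies on the boundary, so the mean value theorem is
   applied between [x] and a point [xs s] shortly before [y], where [g] is at most [eps] in absolute
   value by continuity up to the closure. *)
apply/ler_addgt0Pr => eps eps0.
have gN : \forall z \near y, closure D z -> `|g z| <= eps.
  have /subspace_continuousP/(_ y cly)/cvgrPdist_le/(_ eps eps0) := gcl.
  rewrite near_withinE; apply: filterS => z h /h.
  by rewrite -[from_subspace _ _ y]/(g y) -[from_subspace _ _ z]/(g z) gy sub0r normrN.
have [s [s0 st gz]] := approach _ gN.
have Dz := xs_D s (ltW s0) st; have {}gz := gz (subset_closure Dz).
have [t /andP[t0 ts]|c /andP[c0 cs] cE] :=
    @MVT_line R V g (fun w => (-1) ^+ b * dg i w) (xs s) e s s0.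
  have Dt : D (xs s + t *: e).
    rewrite /xs -addrA -scalerDl (_ : - s + t = - (s - t)); last by ring.
    by apply: xs_D; lra.
  exact: is_derive_scale ((gC _ Dt).2 i).1.
have xE : xs s + s *: e = x by rewrite /xs -addrA -scalerDl addNr scale0r addr0.
have dcL : `|(-1) ^+ b * dg i (xs s + c *: e)| <= L.
  rewrite normrM normr_sign mul1r gL// /xs -addrA -scalerDl.
  rewrite (_ : - s + c = - (s - c)); last by ring.
  by apply: xs_D; lra.
have : `|g x - g (xs s)| <= L * tau.
  rewrite -{1}xE cE normrM gtr0_norm//.
  by rewrite mulrC ler_pM// ltW.
have := ler_normD (g x - g (xs s)) (g (xs s)); rewrite subrK; lra.
Qed.

End boundary_decay.

(** * The Stokes system *)

Section closure_bounds.
Context {R : realType} {n : nat}.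
Local Notation V := 'rV[R]_n.
Variables (D : set V) (M : R).
Hypothesis DM : forall x, D x -> `|x| <= M.

Lemma compact_closure : compact (closure D).
Proof.
apply: (subclosed_compact _ (@compact_closed_ball_rV R n M)).
  exact: closed_closure.
have cl := compact_closed (@norm_hausdorff _ _) (@compact_closed_ball_rV R n M).
by move/closure_id : cl => ->; exact: closure_subset.
Qed.

Lemma closure_bounded (f : V -> R) : {within closure D, continuous f} ->
  exists2 K, 0 <= K & forall x, D x -> `|f x| <= K.
Proof.
move=> cf; have [K fK] := continuous_compact_bounded compact_closure cf.
exists (Num.max K 0) => [|x Dx]; first by rewrite le_max lexx orbT.
by rewrite le_max fK//; exact: subset_closure.
Qed.

Lemma closure_bounded_family m (f : 'I_m -> V -> R) :
  (forall k, {within closure D, continuous (f k)}) ->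
  exists2 K, 0 <= K & forall k x, D x -> `|f k x| <= K.
Proof.
move=> cf.
have H k : exists K : R, 0 <= K /\ forall x, D x -> `|f k x| <= K.
  by have [K K0 fK] := closure_bounded (cf k); exists K.
pose K k := sval (cid (H k)).
have KP k : 0 <= K k /\ forall x, D x -> `|f k x| <= K k := svalP (cid (H k)).
exists (\sum_k K k); first by apply: sumr_ge0 => k _; exact: (KP k).1.
move=> k x Dx; apply: (le_trans ((KP k).2 x Dx)).
rewrite (bigD1 k)//= lerDl; apply: sumr_ge0 => j _; exact: (KP j).1.
Qed.

End closure_bounds.

(** * The weighted estimate for the stress field *)

Section stokes.
Context {R : realType} {n : nat}.
Local Notation V := 'rV[R]_n.
Local Notation mu := (@lebesgue_rV R n).
Variables (Omega : set V) (x0 : V) (r M : R) (i0 : 'I_n) (b : bool)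
  (rho : V -> R) (drho : 'I_n -> V -> R) (d2rho : 'I_n -> 'I_n -> V -> R).
Hypotheses (oO : open Omega) (OM : forall x, Omega x -> `|x| <= M) (r0 : 0 < r)
  (ch : convex_chart Omega x0 (2 * r) i0 b rho drho d2rho).

Let D := Dset Omega x0 (2 * r).

Variables (U : 'I_n -> 'I_n -> V -> R) (H : 'I_n -> 'I_n -> 'I_n -> V -> R)
  (phi : V -> R) (dphi : 'I_n -> V -> R).
Hypotheses (UC : forall j k, C1 D (U j k) (fun i => H i j k))
  (phiC : C1 D phi dphi)
  (clU : forall j k, {within closure D, continuous (U j k)})
  (clH : forall i j k, {within closure D, continuous (H i j k)})
  (clphi : {within closure D, continuous phi})
  (cldphi : forall i, {within closure D, continuous (dphi i)}).
Hypotheses (Hsym : forall i j k x, D x -> H i j k x = H j i k x)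
  (Hdiv : forall i x, D x -> \sum_k H i k k x = 0)
  (Hstokes : forall k x, D x -> \sum_j H j j k x = dphi k x).

(** Index convention: [U j k] is [d_j u_k] and [H i j k] is [d_i d_j u_k]. For fixed [k], [stress k]
    is one divergence-free row, and [dF k i j] is the i-th derivative of its j-th entry. *)
Definition stress k j x := U j k x - phi x * (j == k)%:R.
Let dF k i j x := H i j k x - dphi i x * (j == k)%:R.

Hypothesis bc : forall y k, Iset Omega x0 (2 * r) y ->
  \sum_j stress k j y * drho j y = 0.

(* The cutoff lives on the ball of radius 3r/2, so that a point of its support
   with |rho| < r/2 reaches the boundary along the axis inside B(x0, 2r). *)
Let a : R := 9 / 4 * r ^+ 2.
Let zeta := radial_cutoff x0 a.
Let dzeta := radial_cutoff' x0 a.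
Let E x := \sum_i \sum_j \sum_k H i j k x ^+ 2 + \sum_i dphi i x ^+ 2.

Let a0 : 0 <= a. Proof. by rewrite mulr_ge0 ?sqr_ge0// divr_ge0. Qed.

Let oD : open D.
Proof. by apply: openI => //; exact: eball_open. Qed.

Let DM x : D x -> `|x| <= M. Proof. by move=> [_ /OM]. Qed.

Let FC k j : C1 D (stress k j) (fun i => dF k i j).
Proof.
have := C1D (UC j k) (C1M phiC (@C1_cst R n D (- (j == k)%:R))).
apply: C1_eq => // x Dx => [|i]; rewrite /stress /dF /cst; first by rewrite mulrN.
by ring.
Qed.

Let divF k x : D x -> \sum_j dF k j j x = 0.
Proof.
move=> Dx; rewrite sumrB Hstokes// (bigD1 k)//= big1 => [|j jk].
  by rewrite eqxx mulr1 addr0 subrr.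
by rewrite (negbTE jk) mulr0.
Qed.

Let sum_delta (f : 'I_n -> R) k : \sum_j f j * (j == k)%:R = f k.
Proof.
rewrite (bigD1 k)//= eqxx mulr1 big1 ?addr0// => j jk.
by rewrite (negbTE jk) mulr0.
Qed.

Let sum_delta2 x : D x -> \sum_k \sum_i \sum_j (dphi i x * H i j k x * (j == k)%:R) = 0.
Proof.
move=> Dx; rewrite exchange_big big1// => i _.
under eq_bigr do rewrite sum_delta.
by rewrite -mulr_sumr Hdiv// mulr0.
Qed.

Let TE x : D x -> \sum_k \sum_i \sum_j dF k i j x * dF k j i x = E x.
Proof.
move=> Dx.
transitivity (\sum_k \sum_i \sum_j H i j k x ^+ 2
  - \sum_k \sum_i \sum_j (dphi i x * H i j k x * (j == k)%:R)
  - \sum_k \sum_i \sum_j (dphi j x * H j i k x * (i == k)%:R)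
  + \sum_k \sum_i \sum_j (dphi i x * (dphi j x * (j == k)%:R) * (i == k)%:R)).
  rewrite -!sumrB -big_split/=; apply: eq_bigr => k _.
  rewrite -!sumrB -big_split/=; apply: eq_bigr => i _.
  rewrite -!sumrB -big_split/=; apply: eq_bigr => j _.
  rewrite /dF (Hsym j i k Dx); ring.
rewrite sum_delta2// subr0.
have -> : \sum_k \sum_i \sum_j (dphi j x * H j i k x * (i == k)%:R) = 0.
  rewrite -[RHS](sum_delta2 Dx); apply: eq_bigr => k _; exact: exchange_big.
rewrite subr0; congr (_ + _).
  rewrite exchange_big; apply: eq_bigr => i _; exact: exchange_big.
apply: eq_bigr => k _; under eq_bigr => i _.
  rewrite -mulr_suml -mulr_sumr sum_delta; over.
by rewrite sum_delta expr2.
Qed.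

(** In contrast to [TE], the pressure term is the square of [d_j phi] times the identity matrix,
    whose trace gives the factor [n]. Hence the full square is at most [n] times the quadratic
    form. *)
Let SE x : D x -> \sum_k \sum_i \sum_j dF k j i x ^+ 2 =
  \sum_i \sum_j \sum_k H i j k x ^+ 2 + n%:R * \sum_i dphi i x ^+ 2.
Proof.
move=> Dx.
transitivity (\sum_k \sum_i \sum_j H i j k x ^+ 2
  - 2 * (\sum_k \sum_i \sum_j (dphi j x * H j i k x * (i == k)%:R))
  + \sum_(k < n) \sum_(i < n) \sum_j (dphi j x ^+ 2 * (i == k)%:R)).
  rewrite mulr_sumr -sumrB -big_split/=; apply: eq_bigr => k _.
  rewrite mulr_sumr -sumrB -big_split/=; apply: eq_bigr => i _.
  rewrite mulr_sumr -sumrB -big_split/=; apply: eq_bigr => j _.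
  rewrite /dF (Hsym j i k Dx); case: (i == k); rewrite /= ?mulr0 ?mulr1; ring.
have -> : \sum_k \sum_i \sum_j (dphi j x * H j i k x * (i == k)%:R) = 0.
  rewrite -[RHS](sum_delta2 Dx); apply: eq_bigr => k _; exact: exchange_big.
rewrite mulr0 subr0; congr (_ + _).
  rewrite exchange_big; apply: eq_bigr => i _; exact: exchange_big.
rewrite mulr_sumr.
under eq_bigr => k _ do under eq_bigr => i _ do rewrite -mulr_suml.
under eq_bigr do rewrite sum_delta.
by rewrite sumr_const card_ord -mulr_sumr mulr_natl.
Qed.

Let C1_chart f df : C1 setT f df -> C1 D f df.
Proof. by move=> fC x _; exact: fC. Qed.

(** Continuity up to the boundary, phrased as [continuous_on] for the subspace topology so that the
    same closure rules serve inside [D] and on its closure. *)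
Let cl f := @continuous_on R (subspace (closure D)) setT f.

Let cl_within (f : V -> R) : {within closure D, continuous f} -> cl f.
Proof. by move=> cf x _; exact: cf. Qed.

Let within_cl (f : V -> R) : cl f -> {within closure D, continuous f}.
Proof. by move=> cf x; exact: cf. Qed.

Let cl_C1 f df : C1 setT f df -> cl f.
Proof.
move=> fC; apply: cl_within; apply: continuous_subspaceT => x.
by have [] := fC x I.
Qed.

Let cl_C1' f df i : C1 setT f df -> cl (df i).
Proof.
move=> fC; apply: cl_within; apply: continuous_subspaceT => x.
by have [_ /(_ i)[]] := fC x I.
Qed.

Let cl_stress k j : cl (stress k j).
Proof.
have -> : stress k j = fun x => U j k x + phi x * (- (j == k)%:R).
  by apply/funext => x; rewrite /stress mulrN.
apply: continuous_onD; first exact: cl_within (@clU j k).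
by apply: continuous_onM; [exact: cl_within clphi|exact: continuous_on_cst].
Qed.

Let cl_dF k i j : cl (dF k i j).
Proof.
have -> : dF k i j = fun x => H i j k x + dphi i x * (- (j == k)%:R).
  by apply/funext => x; rewrite /dF mulrN.
apply: continuous_onD; first exact: cl_within (@clH i j k).
by apply: continuous_onM; [exact: cl_within (@cldphi i)|exact: continuous_on_cst].
Qed.

(** The boundary condition says that the normal part vanishes on the boundary, so [boundary_decay]
    bounds it by a multiple of [- rho] on the support of [zeta]; elsewhere the factor [zeta] is
    0. *)
Let normal_stress_bound : exists2 K, 0 <= K & forall k x, D x ->
  `|zeta x * (rho x)^-1 * normal_part drho (stress k) x| <= K.
Proof.
pose g k := normal_part drho (stress k).
pose dg k j x := \sum_i (dF k j i x * drho i x + stress k i x * d2rho i j x).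
have gC k : C1 D (g k) (dg k).
  by apply: C1_sum => i; apply: C1M (FC k i) (C1_chart (chart_C2 ch i)).
have clg k : {within closure D, continuous (g k)}.
  apply: within_cl; apply: continuous_on_sum => i; apply: continuous_onM.
    exact: cl_stress.
  exact: cl_C1' (chart_C1 ch).
have cldg k : {within closure D, continuous (dg k i0)}.
  apply: within_cl; apply: continuous_on_sum => i; apply: continuous_onD.
    by apply: continuous_onM; [exact: cl_dF|exact: cl_C1' (chart_C1 ch)].
  by apply: continuous_onM; [exact: cl_stress|exact: cl_C1' (chart_C2 ch i)].
have [B B0 gB] := closure_bounded_family DM clg.
have [L L0 gL] := closure_bounded_family DM cldg.
pose m := Num.max L (2 * B / r).
have m0 : 0 <= m by rewrite /m le_max L0.
exists (a ^+ 2 * m) => [|k x Dx]; first by rewrite mulr_ge0// exprn_ge0.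
have [->|z0] := eqVneq (zeta x) 0.
  by rewrite !mul0r normr0 mulr_ge0// exprn_ge0.
have rx : 0 < - rho x.
  by have [xb Ox] := Dx; rewrite oppr_gt0; apply/(chart_in ch xb).
have gd := boundary_decay oO r0 ch (gC k) (clg k) (gB k) (gL k)
  (fun y => @bc y k) Dx (radial_cutoff_gt0 z0).
have z1 := radial_cutoff_le x0 x a0; have zz := radial_cutoff_ge0 x0 a x.
rewrite -mulrA normrM (ger0_norm zz); apply: ler_pM => //.
have rxE : `|rho x| = - rho x by rewrite ltr0_norm// -oppr_gt0.
by rewrite mulrC normrM normfV rxE ler_pdivrMr.
Qed.

Lemma stokes_weighted : (0 < n)%N ->
  \int[mu]_(x in D) (zeta x ^+ 2 * E x) <=
  64 * n%:R * a ^+ 3 * \int[mu]_(x in D) (\sum_k \sum_j stress k j x ^+ 2).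
Proof.
move=> n0; have mD : measurable D by exact: open_measurable_rV.
have zC := radial_cutoff_C1 x0 a.
pose S2 x := \sum_k \sum_j stress k j x ^+ 2.
pose Z x := \sum_k \sum_i \sum_j (dzeta i x * stress k j x) ^+ 2.
have ZE x : Z x = (\sum_i dzeta i x ^+ 2) * S2 x.
  rewrite mulr_sumr; apply: eq_bigr => k _; rewrite mulr_suml.
  apply: eq_bigr => i _; rewrite mulr_sumr; apply: eq_bigr => j _.
  by rewrite exprMn.
have S2_0 x : 0 <= S2 x by do 2!(apply: sumr_ge0 => ? _); exact: sqr_ge0.
have Z0 x : 0 <= Z x by do 3!(apply: sumr_ge0 => ? _); exact: sqr_ge0.
have Z_le x : Z x <= 16 * a ^+ 3 * S2 x.
  by rewrite ZE ler_wpM2r// radial_cutoff'_sqr.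
have n_gt0 : 0 < n%:R :> R by rewrite ltr0n.
(* By [TE] and [SE], [S <= n T], so this [c] gives [c * S <= T / 2]. With the gradient bound
   [16 * a ^+ 3] it yields the constant [64 * n = 2 * (2 * n) * 16]. *)
pose c : R := (2 * n%:R)^-1; have c0 : 0 < c by rewrite invr_gt0 mulr_gt0.
have clS2 : cl S2.
  apply: continuous_on_sum => k; apply: continuous_on_sum => j.
  by apply: continuous_onX; exact: cl_stress.
have clZ : cl Z.
  apply: continuous_on_sum => k; apply: continuous_on_sum => i.
  apply: continuous_on_sum => j; apply: continuous_onX.
  by apply: continuous_onM; [exact: cl_C1' zC|exact: cl_stress].
have clT : cl (fun x => zeta x ^+ 2 *
    \sum_k \sum_i \sum_j dF k i j x * dF k j i x).
  apply: continuous_onM; first by apply: continuous_onX; exact: cl_C1 zC.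
  apply: continuous_on_sum => k; apply: continuous_on_sum => i.
  by apply: continuous_on_sum => j; apply: continuous_onM; exact: cl_dF.
have clA k : {within closure D, continuous (fun x => \sum_j stress k j x * dzeta j x)}.
  apply: within_cl; apply: continuous_on_sum => j.
  by apply: continuous_onM; [exact: cl_stress|exact: cl_C1' zC].
have [KT KT0 TK] := closure_bounded DM (within_cl clT).
have [KZ KZ0 ZK] := closure_bounded DM (within_cl clZ).
have [KA KA0 AK] := closure_bounded_family DM clA.
have [KG KG0 GK] := normal_stress_bound.
have [KS KS0 SK] := closure_bounded DM (within_cl clS2).
pose K := KT + KZ + KA + KG.
have cont (f : V -> R) : cl f -> forall x, D x -> {for x, continuous f}.
  by move=> /within_cl fc x Dx; exact: within_closure_continuous fc Dx.
have iS2 : mu.-integrable D (EFin \o S2).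
  exact: (integrable_bounded_open oD DM (cont _ clS2) SK).
have iZ : mu.-integrable D (EFin \o Z).
  exact: (integrable_bounded_open oD DM (cont _ clZ) ZK).
have := @weighted_estimate R n D M oD DM rho drho d2rho (C1_chart (chart_C1 ch))
  (fun j => C1_chart (chart_C2 ch j)) _ _ zeta dzeta (C1_chart zC) _ stress dF
  FC divF c K c0 _ _ _ _ _.
have -> : \int[mu]_(x in D) (zeta x ^+ 2 * \sum_k \sum_i \sum_j dF k i j x * dF k j i x) =
    \int[mu]_(x in D) (zeta x ^+ 2 * E x).
  by apply: eq_Rintegral => x /[!inE] Dx; rewrite TE.
move=> WE; apply: le_trans (WE _ _ _ _ _ _ _ _) _.
- by move=> x [xb Ox]; exact/(chart_in ch xb).
- by move=> x v [xb _]; exact: (chart_convex ch v xb).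
- move=> x nDx; have [xb|xb] := pselect (eball x0 (2 * r) x).
    right; split; first by have [] := chart_C1 ch I (x := x).
    rewrite leNgt; apply/negP => rx; apply: nDx; split => //.
    exact/(chart_in ch xb).
  left; have ax : a < enorm (x - x0) ^+ 2.
    move/negP : xb; rewrite -leNgt => xb.
    apply: (@lt_le_trans _ _ ((2 * r) ^+ 2)).
      by have := exprn_gt0 2 r0; rewrite /a exprMn; lra.
    by rewrite lerXn2r ?nnegrE ?enorm_ge0// mulr_ge0// ltW.
  by apply: filterS (radial_cutoff_vanishes ax) => y zy _.
- move=> x Dx; rewrite TE// SE// /c /E.
  have h1 : 0 <= \sum_i \sum_j \sum_k H i j k x ^+ 2.
    by do 3!(apply: sumr_ge0 => ? _); exact: sqr_ge0.
  rewrite mulrC ler_pdivrMr ?mulr_gt0//; set h := \sum_i _ in h1 *.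
  have n1 : 1 <= n%:R :> R by rewrite ler1n.
  set p := \sum_i _; nra.
- move=> x Dx; apply: le_trans (ler_norm _) _; apply: le_trans (TK x Dx) _.
  rewrite /K; lra.
- move=> x Dx; apply: le_trans (ler_norm _) _; apply: le_trans (ZK x Dx) _.
  rewrite /K; lra.
- by move=> k x Dx; apply: le_trans (GK k x Dx) _; rewrite /K; lra.
- by move=> k x Dx; apply: le_trans (AK k x Dx) _; rewrite /K; lra.
have : \int[mu]_(x in D) Z x <= 16 * a ^+ 3 * \int[mu]_(x in D) S2 x.
  rewrite -RintegralZl//; apply: le_Rintegral => //.
  have := integrableZl mD (16 * a ^+ 3) iS2; exact: eq_integrable.
rewrite -/(Z _) -/(S2 _).
set I1 := \int[mu]_(x in D) Z x; set I2 := \int[mu]_(x in D) S2 x => I12.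
rewrite /c invrK -/I1.
have -> : 64 * n%:R * a ^+ 3 * I2 = 2 * (2 * n%:R) * (16 * a ^+ 3 * I2) by ring.
by rewrite ler_pM2l// !mulr_gt0.
Qed.

End stokes.

(** * Derivatives and their continuous extensions to the closure *)

Section extension_of_derivatives.
Context {R : realType} {n : nat}.
Local Notation V := 'rV[R]_n.
Local Notation mu := (@lebesgue_rV R n).

Lemma within_coord (T : topologicalType) (D : set T) m (f : T -> 'rV[R]_m) k :
  {within D, continuous f} -> {within D, continuous (fun x => f x 0 k)}.
Proof.
move=> cf x; apply: (@continuous_comp _ _ _ (f : subspace D -> _)
  (fun v : 'rV[R]_m => v 0 k)); first exact: cf.
exact: coord_continuous.
Qed.

Lemma partialbarE (D : set V) (W : normedModType R) (f : V -> W) i (g : V -> W) y :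
  open D -> (forall x, D x -> partial i f x = g x) ->
  {within closure D, continuous g} -> closure D y -> partialbar D i f y = g y.
Proof.
move=> oD fg /subspace_continuousP gc Dy.
have PF : ProperFilter (within D (nbhs y)) by exact: within_nbhs_proper.
apply/cvg_lim; first exact: norm_hausdorff.
have : g x @[x --> within D (nbhs y)] --> g y.
  apply: cvg_trans (gc y Dy); apply: cvg_app; apply: within_subset.
  exact: subset_closure.
apply: cvg_trans; apply: near_eq_cvg.
by rewrite near_withinE; near=> x => Dx; rewrite fg.
Unshelve. all: by end_near. Qed.

(** [partial j f] and its extension [g] agree only on [D]; since [D] is open, this suffices to
    differentiate once more. *)
Lemma partial_partialE (D : set V) (W : normedModType R) (f g : V -> W) i j x dg :
  open D -> D x -> (forall y, D y -> partial j f y = g y) ->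
  is_derive x (delta_mx 0 i) g dg -> partial i (partial j f) x = dg.
Proof.
move=> oD Dx fg gd; rewrite /partial.
rewrite (near_eq_derive _ (g := g)); first by case: gd.
have DN : \forall y \near x, D y by exact: open_nbhs_nbhs.
by near=> y; apply: fg; near: y.
Unshelve. all: by end_near. Qed.

Lemma closure_Dset (Omega : set V) x0 (r : R) y :
  eball x0 r y -> closure Omega y -> closure (Dset Omega x0 r) y.
Proof.
move=> yb clO A Ay; have BN : nbhs y (eball x0 r).
  by apply: open_nbhs_nbhs; split => //; exact: eball_open.
by have [z [Oz [Az zb]]] := clO _ (filterI Ay BN); exists z; split.
Qed.

Lemma continuous_on_comp (T : topologicalType) (D : set T) (f : T -> R) (g : R -> R) :
  continuous g -> continuous_on D f -> continuous_on D (fun x => g (f x)).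
Proof.
by move=> cg cf x Dx; exact: (continuous_comp (cf x Dx) (cg (f x))).
Qed.

Lemma integrable_fineK (D : set V) (f : V -> R) : measurable D ->
  mu.-integrable D (EFin \o f) ->
  (\int[mu]_(x in D) (f x)%:E)%E = (\int[mu]_(x in D) f x)%:E.
Proof. by move=> mD fi; rewrite /Rintegral fineK//; exact: integrable_fin_num. Qed.

End extension_of_derivatives.

Theorem theorem2p1 (R : realType) (d : nat) (hd : (2 <= d)%N) :
  exists C : R, 0 < C /\
  forall Omega : set 'rV[R]_d,
    Omega !=set0 -> open Omega -> bounded_set Omega -> convex_set Omega ->
    Ck_boundary 2 Omega ->
  exists r0 : R, 0 < r0 /\
  forall (x0 : 'rV[R]_d) (r : R)
    (u : 'rV[R]_d -> 'rV[R]_d) (phi : 'rV[R]_d -> R),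
    boundary Omega x0 -> 0 < r -> r < r0 ->
    Ckbar 2 (Dset Omega x0 (2 * r)) u ->
    Ckbar 1 (Dset Omega x0 (2 * r)) phi ->
    (forall x, Dset Omega x0 (2 * r) x -> - laplacian u x + grad phi x = 0) ->
    (forall x, Dset Omega x0 (2 * r) x -> div u x = 0) ->
    (forall y nu, Iset Omega x0 (2 * r) y -> outward_unit_normal Omega y nu ->
       conormal (Dset Omega x0 (2 * r)) u phi nu y = 0) ->
    (\int[lebesgue_rV d]_(x in Dset Omega x0 r)
        ((hess_norm u x + enorm (grad phi x)) ^+ 2)%:E
     <= (C / r ^+ 2)%:E *
        \int[lebesgue_rV d]_(x in Dset Omega x0 (2 * r))
          ((grad_norm u x + `|phi x|) ^+ 2)%:E)%E.
Proof.
have d0 : (0 < d)%N by exact: leq_trans hd.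
(* The factors collected at the end multiply to [(864 / 25 * d) ^+ 2], and [864 / 25 = 34.56]. *)
exists ((35 * d%:R) ^+ 2); split; first by rewrite exprn_gt0// mulr_gt0// ltr0n.
move=> Omega _ oO bO cO kO.
have [r0 r00 r0P] := convex_chart_exists oO bO cO kO.
exists r0; split => // x0 r u phi Bx0 r_gt0 rr0 u2 phi1 ustokes udiv ubc.
have [i0 [b [rho [drho [d2rho ch]]]]] := r0P x0 r Bx0 r_gt0 rr0.
have [M OM] : exists M : R, forall x, Omega x -> `|x| <= M.
  by have [M [_ MP]] := bO; exists (M + 1) => x Ox; apply: (MP (M + 1)) => //; rewrite ltrDl.
set D := Dset Omega x0 (2 * r) in u2 phi1 ustokes udiv ubc *.
have oD : open D by apply: openI => //; exact: eball_open.
have DM x : D x -> `|x| <= M by move=> [_ /OM].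
have mD : measurable D by exact: open_measurable_rV.
have [Uv UvP] := Ckbar_partials u2.
have [Hv HvP] : exists Hv : 'I_d -> 'I_d -> 'rV[R]_d -> 'rV[R]_d, forall j i,
    Ckbar 0 D (Hv j i) /\ forall x, D x -> is_derive x (delta_mx 0 i) (Uv j) (Hv j i x).
  have HH j := Ckbar_partials (UvP j).1.
  by exists (fun j => sval (cid (HH j))) => j; exact: svalP (cid (HH j)).
have [dphi [phiC dphi0]] := Ckbar_C1 oD phi1.
pose U j k x := Uv j x 0 k; pose H i j k x := Hv j i x 0 k.
have clUv j : {within closure D, continuous (Uv j)} := Ckbar_continuous (UvP j).1.
have clU j k : {within closure D, continuous (U j k)} by exact: within_coord.
have clH i j k : {within closure D, continuous (H i j k)}.
  by apply: within_coord; exact: Ckbar_continuous (HvP j i).1.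
have clphi : {within closure D, continuous phi} := Ckbar_continuous phi1.
have cldphi i : {within closure D, continuous (dphi i)} := Ckbar_continuous (dphi0 i).
have UC j k : C1 D (U j k) (fun i => H i j k).
  move=> x Dx; split; first exact: within_closure_continuous (clU j k) Dx.
  move=> i; split; last exact: within_closure_continuous (clH i j k) Dx.
  by apply: is_derive_coord; exact: (HvP j i).2.
have uE j x : D x -> partial j u x = Uv j x.
  by move=> Dx; exact: (@derive_val _ _ _ _ _ _ _ ((UvP j).2 x Dx)).
have uuE i j x : D x -> partial i (partial j u) x = Hv j i x.
  by move=> Dx; apply: (partial_partialE oD Dx (uE j)); exact: (HvP j i).2.
have phiE i x : D x -> partial i phi x = dphi i x.
  by move=> Dx; exact: (@derive_val _ _ _ _ _ _ _ ((phiC x Dx).2 i).1).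
have DN x : D x -> \forall y \near x, D y by move=> Dx; exact: open_nbhs_nbhs.
have ud i k x : D x -> is_derive x (delta_mx 0 i) (fun y => u y 0 k) (U i k x).
  by move=> Dx; apply: is_derive_coord; exact: (UvP i).2.
have Hsym i j k x : D x -> H i j k x = H j i k x.
  move=> Dx; apply: (@schwarz _ _ (fun y => u y 0 k) (U j k) (U i k) _ _ x
    (delta_mx 0 j) (delta_mx 0 i)).
  - by apply: filterS (DN x Dx) => y; exact: ud.
  - by apply: filterS (DN x Dx) => y; exact: ud.
  - by apply: filterS (DN x Dx) => y Dy; exact: ((UC j k y Dy).2 i).1.
  - by apply: filterS (DN x Dx) => y Dy; exact: ((UC i k y Dy).2 j).1.
  - exact: ((UC j k x Dx).2 i).2.
  - exact: ((UC i k x Dx).2 j).2.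
have divU x : D x -> \sum_k U k k x = 0.
  by move=> Dx; rewrite -[RHS](udiv x Dx); apply: eq_bigr => k _; rewrite uE.
have Hdiv i x : D x -> \sum_k H i k k x = 0.
  move=> Dx.
  have [_ /(_ i)[h1 _]] := C1_sum (fun k => UC k k) Dx.
  have h2 : is_derive x (delta_mx 0 i) (fun x => \sum_k U k k x) 0.
    apply: (@near_eq_is_derive _ _ _ (cst 0)).
    by apply: filterS (DN x Dx) => y /divU ->.
  by rewrite -(@derive_val _ _ _ _ _ _ _ h1) (@derive_val _ _ _ _ _ _ _ h2).
have Hstokes k x : D x -> \sum_j H j j k x = dphi k x.
  move=> Dx; have /rowP/(_ k) := ustokes x Dx.
  rewrite !mxE phiE// /laplacian summxE => /eqP.
  rewrite addrC subr_eq0 => /eqP ->; apply: eq_bigr => j _.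
  by rewrite uuE.
have bc y k : Iset Omega x0 (2 * r) y -> \sum_j stress U phi k j y * drho j y = 0.
  (* The condition is used for the unit normal [c *: grad rho] supplied by the chart, and the
     nonzero factor [c] is then divided out. *)
  move=> Iy; have [c c0 /(ubc y _ Iy)] := chart_normal ch Iy.
  have cly : closure D y by case: Iy => yb [cO' _]; exact: closure_Dset.
  move=> /rowP/(_ k); rewrite /conormal !mxE summxE.
  have -> : \sum_j ((c *: \row_j0 drho j0 y) 0 j *: partialbar D j u y) 0 k -
      phi y * (c * drho k y) = c * \sum_j stress U phi k j y * drho j y.
    rewrite mulr_sumr [phi y * _](_ : _ = \sum_j c * (phi y * (j == k)%:R) * drho j y).
      rewrite -sumrB; apply: eq_bigr => j _; rewrite !mxE.
      by rewrite (partialbarE oD (uE j) (clUv j) cly) /stress /U; ring.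
    rewrite (bigD1 k)//= eqxx big1 => [|j jk]; first by rewrite /=; ring.
    by rewrite (negbTE jk)/= !(mulr0, mul0r).
  by move/eqP; rewrite mulf_eq0 (negbTE c0) => /eqP.
have SW := @stokes_weighted R d Omega x0 r M i0 b rho drho d2rho oO OM r_gt0 ch
  U H phi dphi UC phiC clU clH clphi cldphi Hsym Hdiv Hstokes bc d0.
rewrite -/D in SW; set a := 9 / 4 * r ^+ 2 in SW.
pose h2 x := \sum_i \sum_j \sum_k H i j k x ^+ 2.
pose p2 x := \sum_i dphi i x ^+ 2.
pose U2 x := \sum_i \sum_k U i k x ^+ 2.
pose s2 x := \sum_k \sum_j stress U phi k j x ^+ 2.
pose w2 x := radial_cutoff x0 a x ^+ 2 * (h2 x + p2 x).
pose ff x := (Num.sqrt (h2 x) + Num.sqrt (p2 x)) ^+ 2.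
pose gg x := (Num.sqrt (U2 x) + `|phi x|) ^+ 2.
have h20 x : 0 <= h2 x by do 3!(apply: sumr_ge0 => ? _); exact: sqr_ge0.
have p20 x : 0 <= p2 x by apply: sumr_ge0 => ? _; exact: sqr_ge0.
have U20 x : 0 <= U2 x by do 2!(apply: sumr_ge0 => ? _); exact: sqr_ge0.
have s20 x : 0 <= s2 x by do 2!(apply: sumr_ge0 => ? _); exact: sqr_ge0.
have w20 x : 0 <= w2 x by rewrite mulr_ge0 ?sqr_ge0// addr_ge0.
pose cl f := @continuous_on R (subspace (closure D)) setT f.
have wcl (f : 'rV[R]_d -> R) : {within closure D, continuous f} -> cl f.
  by move=> cf x _; exact: cf.
have clh2 : cl h2.
  do 3!(apply: continuous_on_sum => ?); apply: continuous_onX.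
  exact: wcl.
have clp2 : cl p2.
  by apply: continuous_on_sum => i; apply: continuous_onX; exact: wcl.
have clU2 : cl U2.
  by do 2!(apply: continuous_on_sum => ?); apply: continuous_onX; exact: wcl.
have cls2 : cl s2.
  apply: continuous_on_sum => k; apply: continuous_on_sum => j.
  apply: continuous_onX.
  rewrite (_ : stress U phi k j = fun x => U j k x + phi x * (- (j == k)%:R)).
    apply: continuous_onD; first exact: wcl (clU j k).
    by apply: continuous_onM; [exact: wcl clphi|exact: continuous_on_cst].
  by apply/funext => x; rewrite /stress mulrN.
have clw2 : cl w2.
  apply: continuous_onM; last exact: continuous_onD.
  apply: continuous_onX; apply: wcl; apply: continuous_subspaceT => x.
  by have [] := radial_cutoff_C1 x0 a I (x := x).
have clff : cl ff.
  apply: continuous_onX; apply: continuous_onD; apply: continuous_on_comp => //;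
    exact: sqrt_continuous.
have clgg : cl gg.
  apply: continuous_onX; apply: continuous_onD; apply: continuous_on_comp.
  - exact: sqrt_continuous.
  - exact: clU2.
  - exact: norm_continuous.
  - exact: wcl clphi.
(* The extensions are continuous on a compact set, hence bounded. Replacing the derivatives by them
   on [D] makes the integrals finite, so that they can be handled as real numbers. *)
have int f : cl f -> (lebesgue_rV d).-integrable D (EFin \o f).
  move=> clf; have cf : {within closure D, continuous f} by move=> x; exact: clf.
  have [K _ fK] := closure_bounded DM cf.
  apply: (integrable_bounded_open oD DM _ fK) => x Dx.
  exact: within_closure_continuous cf Dx.
have meas f : cl f -> measurable_fun D f.
  by move=> /int/measurable_int/measurable_EFinP.
pose Dr := Dset Omega x0 r.
have DrD : Dr `<=` D.
  move=> x [xr Ox]; split => //; apply: lt_le_trans xr _.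
  by rewrite ler_pMl// ler1n.
have mDr : measurable Dr.
  by apply: open_measurable_rV; apply: openI => //; exact: eball_open.
have LE x : D x -> (hess_norm u x + enorm (grad phi x)) ^+ 2 = ff x.
  move=> Dx; rewrite /ff /hess_norm /enorm; congr ((Num.sqrt _ + Num.sqrt _) ^+ 2).
    do 3!(apply: eq_bigr => ? _); by rewrite uuE.
  by apply: eq_bigr => i _; rewrite mxE phiE.
have RE x : D x -> (grad_norm u x + `|phi x|) ^+ 2 = gg x.
  move=> Dx; rewrite /gg /grad_norm; congr ((Num.sqrt _ + _) ^+ 2).
  by do 2!(apply: eq_bigr => ? _); rewrite uE.
have -> : (\int[lebesgue_rV d]_(x in D) ((grad_norm u x + `|phi x|) ^+ 2)%:E =
    (\int[lebesgue_rV d]_(x in D) gg x)%:E)%E.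
  rewrite -integrable_fineK//; last exact: int.
  by apply: eq_integral => x /[!inE] Dx; rewrite RE.
have -> : (\int[lebesgue_rV d]_(x in Dset Omega x0 r)
    ((hess_norm u x + enorm (grad phi x)) ^+ 2)%:E =
    \int[lebesgue_rV d]_(x in Dr) (ff x)%:E)%E.
  by apply: eq_integral => x /[!inE] Dx; rewrite LE//; exact: DrD.
(* On the ball of radius [r] one has [a - |x - x0|^2 >= 5 / 4 * r ^+ 2], whose fourth power bounds
   the squared cutoff from below. The 2 comes from [(A + B)^2 <= 2 (A^2 + B^2)]. *)
pose kappa := 2 / (5 / 4 * r ^+ 2) ^+ 4.
have r2 : 0 < r ^+ 2 by exact: exprn_gt0.
have k0 : 0 < kappa by rewrite divr_gt0// exprn_gt0// mulr_gt0// divr_gt0.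
have clkw : cl (fun x => kappa * w2 x).
  by apply: continuous_onM => //; exact: continuous_on_cst.
have ff_le x : Dr x -> ff x <= kappa * w2 x.
  move=> [xr _].
  have Nr : enorm (x - x0) ^+ 2 < r ^+ 2.
    by rewrite ltr_pXn2r ?nnegrE ?enorm_ge0// ltW.
  have z1 : (5 / 4 * r ^+ 2) ^+ 4 <= radial_cutoff x0 a x ^+ 2.
    rewrite /radial_cutoff -exprM lerXn2r ?nnegrE ?pos_ge0//.
      by rewrite mulr_ge0 ?sqr_ge0// divr_ge0.
    by rewrite /pos le_max /a; apply/orP; left; lra.
  apply: (@le_trans _ _ (2 * (h2 x + p2 x))).
    have := sqr_sqrtr (h20 x); have := sqr_sqrtr (p20 x).
    rewrite /ff; set A := Num.sqrt _; set B := Num.sqrt _ => <- <-.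
    have := sqr_ge0 (B - A); nra.
  have kp : 0 < (5 / 4 * r ^+ 2) ^+ 4 by rewrite exprn_gt0// mulr_gt0// divr_gt0.
  have -> : kappa * w2 x = 2 * (h2 x + p2 x) *
      (radial_cutoff x0 a x ^+ 2 / (5 / 4 * r ^+ 2) ^+ 4).
    by rewrite /kappa /w2; ring.
  by rewrite ler_peMr ?mulr_ge0 ?addr_ge0// ler_pdivlMr ?mul1r.
apply: (@le_trans _ _ (\int[lebesgue_rV d]_(x in D) (kappa * w2 x)%:E)%E).
  apply: (@le_trans _ _ (\int[lebesgue_rV d]_(x in Dr) (kappa * w2 x)%:E)%E).
    apply: ge0_le_integral => //.
    - by move=> x _; rewrite lee_fin sqr_ge0.
    - apply/measurable_EFinP; exact: measurable_funS mD DrD (meas _ clff).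
    - apply/measurable_EFinP; exact: measurable_funS mD DrD (meas _ clkw).
  apply: ge0_subset_integral => //.
  - by apply/measurable_EFinP; exact: meas.
  - by move=> x _; rewrite lee_fin mulr_ge0// ltW.
rewrite integrable_fineK//; last exact: int.
rewrite -EFinM lee_fin RintegralZl//; last exact: int.
(* The squared norm of the identity matrix is [d], so [|F|^2 <= 2 |grad u|^2 + 2 d phi^2]. *)
have s2_le x : s2 x <= 2 * d%:R * gg x.
  apply: (@le_trans _ _ (2 * U2 x + 2 * d%:R * phi x ^+ 2)).
    have -> : 2 * U2 x + 2 * d%:R * phi x ^+ 2 = \sum_(k < d) \sum_(j < d)
        (2 * U j k x ^+ 2 + 2 * (phi x ^+ 2 * (j == k)%:R)).
      have -> : d%:R = \sum_(k < d) \sum_(j < d) (j == k)%:R :> R.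
        transitivity (\sum_(k < d) (1 : R)); first by rewrite sumr_const card_ord.
        apply: eq_bigr => k _; rewrite (bigD1 k)//= eqxx big1 ?addr0// => j jk.
        by rewrite (negbTE jk).
      rewrite /U2 exchange_big -mulrA mulr_suml !mulr_sumr -big_split/=.
      apply: eq_bigr => k _; rewrite mulr_suml !mulr_sumr -big_split/=.
      by apply: eq_bigr => j _; ring.
    apply: ler_sum => k _; apply: ler_sum => j _; rewrite /stress.
    have := sqr_ge0 (U j k x + phi x); have := sqr_ge0 (U j k x).
    by case: (j == k); rewrite /= ?(mulr1, mulr0) ?subr0; nra.
  have d1 : 1 <= d%:R :> R by rewrite ler1n.
  have := sqr_sqrtr (U20 x); have := sqrtr_ge0 (U2 x); rewrite /gg.
  set A := Num.sqrt _ => A0 <-; have := real_normK (num_real (phi x)).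
  set B := `|phi x| => <-; have B0 : 0 <= B by exact: normr_ge0.
  have AB : 0 <= A * B by exact: mulr_ge0.
  have A2 := sqr_ge0 A; nra.
have S2 : \int[lebesgue_rV d]_(x in D) s2 x <=
    2 * d%:R * \int[lebesgue_rV d]_(x in D) gg x.
  rewrite -RintegralZl//; last exact: int.
  apply: le_Rintegral => //; first exact: int.
  by apply: int; apply: continuous_onM => //; exact: continuous_on_cst.
have g0 : 0 <= \int[lebesgue_rV d]_(x in D) gg x.
  by apply: Rintegral_ge0 => x _; exact: sqr_ge0.
apply: (@le_trans _ _ (kappa * (64 * d%:R * a ^+ 3 *
    (2 * d%:R * \int[lebesgue_rV d]_(x in D) gg x)))).
  rewrite ler_pM2l//; apply: le_trans SW _; rewrite ler_wpM2l//.
  have a0 : 0 <= a by rewrite mulr_ge0 ?sqr_ge0// divr_ge0.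
  by rewrite mulr_ge0 ?exprn_ge0// mulr_ge0.
set J := \int[_]_(x in D) gg x in g0 *.
(* The powers of [r] are [r ^- 8] from [kappa] and [r ^+ 6] from [a ^+ 3], which leaves [r ^- 2]. *)
have -> : kappa * (64 * d%:R * a ^+ 3 * (2 * d%:R * J)) =
    (6 * 6 * 6 * 4 / 25 * d%:R) ^+ 2 / r ^+ 2 * J.
  by rewrite /kappa /a; field; rewrite gt_eqF.
rewrite ler_wpM2r// ler_pM2r ?invr_gt0// lerXn2r ?nnegrE ?mulr_ge0// ler_wpM2r//; lra.
Qed.
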